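(* Let $M\in\operatorname{GL}_n(\mathbb{C})$, let $X=\{M^k\mid k\in\mathbb{Z}\}$ be the subgroup of $\operatorname{GL}_n(\mathbb{C})$ generated by $M$, and let $\overline{X}$ be its Zariski closure in $\operatorname{Mat}_n(\mathbb{C})$. Let $G(M)$ be the subgroup of $\mathbb{C}^*$ generated by the eigenvalues of $M$. Then $\overline{X}$ has exactly $|G(M)_{\mathrm{tor}}|$ irreducible components, and the irreducible components are pairwise isomorphic toric varieties of dimension $$\dim\overline{X}=\begin{cases}\operatorname{rk} G(M) & \text{if } M \text{ is diagonalizable},\\ \operatorname{rk} G(M)+1 & \text{otherwise.}\end{cases}$$
   Context: $\operatorname{Mat}_n(\mathbb{C})$ is regarded as the affine space $\mathbb{C}^{n^2}$. For a finitely generated abelian group $G$, $G_{\mathrm{tor}}$ denotes its torsion subgroup and $\operatorname{rk} G$ the rank of a free complement of $G_{\mathrm{tor}}$ in $G$; $|\cdot|$ denotes the order of a finite group. Toric varieties are affine and not assumed normal: for lattice points $\alpha_1,\dots,\alpha_m\in\mathbb{Z}^r$, let $Y_{\mathcal{A}}\subseteq\mathbb{C}^m$ be the Zariski closure of the image of the monomial map $(\mathbb{C}^* )^r\to(\mathbb{C}^* )^m$, $x\mapsto(x^{\alpha_1},\dots,x^{\alpha_m})$, where $x^{\alpha_i}=x_1^{\alpha_{i1}}\cdots x_r^{\alpha_{ir}}$. A variety is called toric if it is isomorphic to some $Y_{\mathcal{A}}$ (equivalently, it is an irreducible affine variety containing an algebraic torus as a Zariski open subset such that the action of the torus on itself extends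 to an algebraic action on the variety). *)

(* Defs.v *)
From mathcomp Require Import all_boot all_order all_algebra.
From mathcomp Require Import boolp classical_sets functions cardinality reals.
From mathcomp Require Import complex mpoly.

Set Implicit Arguments.
Unset Strict Implicit.
Unset Printing Implicit Defensive.

Import Order.TTheory GRing.Theory Num.Theory.

Local Open Scope classical_set_scope.
Local Open Scope ring_scope.

(* Affine n-space over K is 'rV[K]_n, with its Zariski topology. *)

Definition zero_locus (K : fieldType) (n : nat) (S : set {mpoly K[n]}) :
    set 'rV[K]_n :=
  [set x | forall p, S p -> p.@[x 0] = 0].

Definition zclosed (K : fieldType) (n : nat) (Z : set 'rV[K]_n) : Prop :=
  exists S : set {mpoly K[n]}, Z = zero_locus S.

Definition zclosure (K : fieldType) (n : nat) (X : set 'rV[K]_n) :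
    set 'rV[K]_n :=
  smallest (@zclosed K n) X.

Definition zirreducible (K : fieldType) (n : nat) (Z : set 'rV[K]_n) : Prop :=
  Z !=set0 /\
  forall A B : set 'rV[K]_n, zclosed A -> zclosed B ->
    Z `<=` A `|` B -> Z `<=` A \/ Z `<=` B.

Definition zcomponents (K : fieldType) (n : nat) (X : set 'rV[K]_n) :
    set (set 'rV[K]_n) :=
  [set Z | [/\ zirreducible Z, Z `<=` X &
    forall W, zirreducible W -> W `<=` X -> Z `<=` W -> W = Z]].

(* A chain Z 0 < Z 1 < ... < Z d of irreducible closed subsets of X.  Meant
   for closed X, whose relatively closed subsets are the closed sets
   contained in X. *)
Definition zchain (K : fieldType) (n : nat) (X : set 'rV[K]_n) (d : nat)
    (Z : nat -> set 'rV[K]_n) : Prop :=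
  (forall i, (i <= d)%N -> [/\ zclosed (Z i), zirreducible (Z i) & Z i `<=` X])
  /\ (forall i, (i < d)%N -> Z i `<` Z i.+1).

Definition has_zdim (K : fieldType) (n : nat) (X : set 'rV[K]_n) (d : nat) :
    Prop :=
  (exists Z, zchain X d Z) /\ (forall e Z, zchain X e Z -> (e <= d)%N).

Definition polymap (K : fieldType) (m n : nat) (f : 'I_n -> {mpoly K[m]})
    (x : 'rV[K]_m) : 'rV[K]_n :=
  \row_i (f i).@[x 0].

Definition zisomorphic (K : fieldType) (m n : nat)
    (Z : set 'rV[K]_m) (W : set 'rV[K]_n) : Prop :=
  exists (f : 'I_n -> {mpoly K[m]}) (g : 'I_m -> {mpoly K[n]}),
    [/\ set_fun Z W (polymap f), set_fun W Z (polymap g),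
        {in Z, cancel (polymap f) (polymap g)} &
        {in W, cancel (polymap g) (polymap f)}].

(* The exponent vectors are the rows of A. *)
Definition monomial_map (K : fieldType) (m r : nat) (A : 'M[int]_(m, r))
    (x : 'rV[K]_r) : 'rV[K]_m :=
  \row_i \prod_(j < r) x 0 j ^ A i j.

Definition toricY (K : fieldType) (m r : nat) (A : 'M[int]_(m, r)) :
    set 'rV[K]_m :=
  zclosure (monomial_map A @` [set x : 'rV[K]_r | forall j, x 0 j != 0]).

Definition toric (K : fieldType) (n : nat) (Z : set 'rV[K]_n) : Prop :=
  exists (m r : nat) (A : 'M[int]_(m, r)), zisomorphic Z (@toricY K m r A).

(* Subgroups of the multiplicative group of K, as subsets of K. *)

Definition mul_subgroup (K : fieldType) (H : set K) : Prop :=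
  [/\ H `<=` [set x | x != 0], H 1 & forall x y, H x -> H y -> H (x / y)].

(* Only meaningful when 0 is not in S: otherwise no subgroup contains S. *)
Definition mul_generated (K : fieldType) (S : set K) : set K :=
  smallest (@mul_subgroup K) S.

Definition torsion (K : fieldType) (G : set K) : set K :=
  [set x | G x /\ exists2 k : nat, (0 < k)%N & x ^+ k = 1].

(* b is a basis of F: every element of F is a product of integer powers of
   the b i, with unique exponents. *)
Definition free_of_rank (K : fieldType) (F : set K) (r : nat) : Prop :=
  exists b : 'I_r -> K,
    set_bij [set: 'rV[int]_r] F (fun e => \prod_(i < r) b i ^ e 0 i).

Definition complement_in (K : fieldType) (G T F : set K) : Prop :=
  [/\ mul_subgroup F, F `<=` G, T `&` F = [set 1] &
      forall x, G x -> exists y z, [/\ T y, F z & x = y * z]].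

Definition has_rank (K : fieldType) (G : set K) (r : nat) : Prop :=
  exists2 F : set K, complement_in G (torsion G) F & free_of_rank F r.

(* Main.v *)
(* Let [t] be the order of the torsion of [G(M)] and [zeta] a primitive [t]-th
   root of unity; every eigenvalue is [zeta^c * b^u] for a basis [b] of a free
   complement.  With [j] below the multiplicity of [lam] in the minimal polynomial,
   the powers [M^k] are, up to a linear embedding, the points with coordinates
   [lam^k * k^j].  Hence the closure of [{M^(t l)}] is the closure of the points
   [(b^(t l))^u * (t l)^j], and since exponential polynomials are linearly
   independent, these are dense in the toric variety with exponent vectors
   [(u, j)]; these vectors generate [Z^r], or [Z^(r+1)] when some [j] is positive.
   The closures of the cosets [{M^(i + t l)}], [i < t], are translates of this one;
   they are not contained in each other because [zeta^k] is a quotient of monomials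
   in the coordinates of [M^k].

   The dimension of a toric variety is bounded above by counting: along a chain of
   irreducible closed sets algebraically independent functions accumulate, and
   their monomials with exponents below [D] restrict to Laurent polynomials with
   exponents [O(D)] in as many variables as the torus has.  A chain of subtori gives
   the lower bound. *)
Require Import Defs.
From mathcomp Require Import all_boot all_order all_algebra.
From mathcomp Require Import boolp classical_sets functions cardinality reals.
From mathcomp Require Import complex mpoly.
From mathcomp Require Import cyclic zify ring.

Set Implicit Arguments.
Unset Strict Implicit.
Unset Printing Implicit Defensive.

Import Order.TTheory GRing.Theory Num.Theory.

Local Open Scope classical_set_scope.
Local Open Scope ring_scope.

(** * Zariski topology *)

(** Each polynomial vanishing on [X] cuts out a closed set containing [X]; questions about closures
    thus become tests on polynomials. *)
Lemma zclosureP (K : fieldType) (n : nat) (X : set 'rV[K]_n) (y : 'rV[K]_n) :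
  zclosure X y <->
  forall p : {mpoly K[n]}, (forall x, X x -> p.@[x 0] = 0) -> p.@[y 0] = 0.
Proof.
split=> [Xy p pX | vy B [[S ->] XS]].
  have: zero_locus [set p] y; last exact.
  by apply: Xy; split=> [|x Xx q ->]; [exists [set p] | exact: pX].
by move=> p Sp; apply: vy => x Xx; apply: XS Xx _ Sp.
Qed.

Lemma zclosed_closure (K : fieldType) (n : nat) (X : set 'rV[K]_n) :
  zclosed (zclosure X).
Proof.
exists [set p | forall x, X x -> p.@[x 0] = 0].
by apply/seteqP; split=> y /zclosureP.
Qed.

Lemma sub_zclosure (K : fieldType) (n : nat) (X : set 'rV[K]_n) :
  X `<=` zclosure X.
Proof. exact: sub_smallest. Qed.

Lemma zclosure_min (K : fieldType) (n : nat) (X B : set 'rV[K]_n) :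
  zclosed B -> X `<=` B -> zclosure X `<=` B.
Proof. exact: smallest_sub. Qed.

Lemma zclosureS (K : fieldType) (n : nat) (X Y : set 'rV[K]_n) :
  X `<=` Y -> zclosure X `<=` zclosure Y.
Proof.
by move=> XY; apply: zclosure_min (subset_trans XY (@sub_zclosure _ _ _));
  exact: zclosed_closure.
Qed.

Lemma eq_zclosure (K : fieldType) (n : nat) (X Y : set 'rV[K]_n) :
  X `<=` zclosure Y -> Y `<=` zclosure X -> zclosure X = zclosure Y.
Proof.
by move=> XY YX; apply/seteqP; split; apply: zclosure_min => //;
  exact: zclosed_closure.
Qed.

(** Products of one equation from each family cut out the union: where some [p] of the first is
    nonzero, every [q] of the second must vanish. *)
Lemma zclosedU (K : fieldType) (n : nat) (A B : set 'rV[K]_n) :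
  zclosed A -> zclosed B -> zclosed (A `|` B).
Proof.
move=> [S ->] [T ->].
exists [set r | exists p q, [/\ S p, T q & r = p * q]].
apply/seteqP; split=> [x ABx _ [p [q [Sp Tq ->]]] | x STx] /=.
  rewrite mevalM; case: ABx => [/(_ p Sp)|/(_ q Tq)] ->.
    by rewrite mul0r.
  by rewrite mulr0.
have [Ax|/existsNP[p /not_implyP[Sp px]]] := pselect (zero_locus S x).
  by left.
right=> q Tq; have /eqP : (p * q).@[x 0] = 0 by apply: STx; exists p, q.
by rewrite mevalM mulf_eq0 => /orP[] /eqP.
Qed.

Lemma zclosedI (K : fieldType) (n : nat) (A B : set 'rV[K]_n) :
  zclosed A -> zclosed B -> zclosed (A `&` B).
Proof.
move=> [S ->] [T ->]; exists (S `|` T).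
apply/seteqP; split=> [x [Sx Tx] p [/Sx|/Tx] //|x STx].
by split=> p ?; apply: STx; [left|right].
Qed.

Lemma zclosed0 (K : fieldType) (n : nat) : zclosed (@set0 'rV[K]_n).
Proof.
exists setT; apply/seteqP; split=> // x /(_ 1 I) /eqP.
by rewrite meval1 oner_eq0.
Qed.

Lemma bigcup_II_recr (T : Type) (F : nat -> set T) (k : nat) :
  \bigcup_(i in `I_k.+1) F i = \bigcup_(i in `I_k) F i `|` F k.
Proof.
apply/seteqP; split=> x.
  move=> [i /=]; rewrite ltnS leq_eqVlt => /orP[/eqP-> Fx|ik Fx].
    by right.
  by left; exists i.
case=> [[i ik Fx]|Fx]; last by exists k => //=.
by exists i => //=; exact: ltnW.
Qed.

Lemma zclosed_bigcup (K : fieldType) (n k : nat) (F : nat -> set 'rV[K]_n) :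
  (forall i, zclosed (F i)) -> zclosed (\bigcup_(i in `I_k) F i).
Proof.
move=> cF; elim: k => [|k IHk].
  by rewrite II0 bigcup_set0; exact: zclosed0.
by rewrite bigcup_II_recr; exact: zclosedU.
Qed.

Lemma zirreducible_bigcup (K : fieldType) (n k : nat) (Z : set 'rV[K]_n)
    (F : nat -> set 'rV[K]_n) :
  (forall i, zclosed (F i)) -> zirreducible Z ->
  Z `<=` \bigcup_(i in `I_k) F i -> exists2 i, (i < k)%N & Z `<=` F i.
Proof.
move=> cF [[z Zz] irrZ]; elim: k => [/(_ z Zz) [] //|k IHk].
rewrite bigcup_II_recr => /irrZ[||/IHk[i ik ZF]|ZF].
- exact: zclosed_bigcup.
- exact: cF.
- by exists i => //; exact: ltnW.
by exists k.
Qed.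

Lemma zirreducible_mul (K : fieldType) (n : nat) (Z : set 'rV[K]_n)
    (f g : {mpoly K[n]}) :
  zirreducible Z -> (forall x, Z x -> (f * g).@[x 0] = 0) ->
  (forall x, Z x -> f.@[x 0] = 0) \/ (forall x, Z x -> g.@[x 0] = 0).
Proof.
move=> [_ irrZ] fgZ.
have [|||Zf|Zg] := irrZ (zero_locus [set f]) (zero_locus [set g]).
- by exists [set f].
- by exists [set g].
- move=> x /fgZ; rewrite mevalM => /eqP; rewrite mulf_eq0.
  by case/orP=> /eqP fx; [left|right] => p ->.
- by left=> x /Zf; exact.
- by right=> x /Zg; exact.
Qed.

(** If [X] is not inside [A], some equation [f] of [A] does not vanish on all of [X]. For each
    equation [g] of [B], one of [f] and [g] vanishes at every point of [X], so [g] vanishes on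
    [X]. *)
Lemma zirreducible_closure (K : fieldType) (n : nat) (X : set 'rV[K]_n) :
  X !=set0 ->
  (forall f g : {mpoly K[n]},
    (forall x, X x -> f.@[x 0] = 0 \/ g.@[x 0] = 0) ->
    (forall x, X x -> f.@[x 0] = 0) \/ (forall x, X x -> g.@[x 0] = 0)) ->
  zirreducible (zclosure X).
Proof.
move=> [x0 Xx0] prX; split; first by exists x0; exact: sub_zclosure.
move=> A B cA cB XAB.
have [XA|nXA] := pselect (X `<=` A); first by left; exact: zclosure_min.
right; apply: zclosure_min => // y Xy.
have [S eA] := cA; have [T eB] := cB.
have [x Xx [f Sf fx]] : exists2 x, X x & exists2 f, S f & f.@[x 0] <> 0.
  apply: contrapT => nex; apply: nXA => x Xx; rewrite eA => f Sf.
  by apply: contrapT => fx; apply: nex; exists x => //; exists f.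
rewrite eB => g Tg; have [|fX|] := prX f g; last exact.
  move=> z /(@sub_zclosure _ _ _) /XAB[]; rewrite ?eA ?eB => Hz.
    by left; exact: Hz.
  by right; exact: Hz.
by case: fx; exact: fX.
Qed.

(** * Polynomial maps and isomorphisms *)

Lemma meval_polymap (K : fieldType) (m n : nat) (f : 'I_n -> {mpoly K[m]})
    (p : {mpoly K[n]}) (x : 'rV[K]_m) :
  p.@[polymap f x 0] = (p \mPo [tuple f i | i < n]).@[x 0].
Proof.
rewrite comp_mpoly_meval; apply: meval_eq => i.
by rewrite tnth_mktuple mxE.
Qed.

Lemma zclosed_preimage (K : fieldType) (m n : nat) (f : 'I_n -> {mpoly K[m]})
    (B : set 'rV[K]_n) : zclosed B -> zclosed (polymap f @^-1` B).
Proof.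
move=> [S ->]; exists [set p \mPo [tuple f i | i < n] | p in S].
apply/seteqP; split=> x.
  by move=> Sx _ [p Sp <-]; rewrite -meval_polymap; exact: Sx.
by move=> Sx p Sp; rewrite meval_polymap; apply: Sx; exists p.
Qed.

Lemma zclosure_polymap (K : fieldType) (m n : nat) (f : 'I_n -> {mpoly K[m]})
    (X : set 'rV[K]_m) (Y : set 'rV[K]_n) :
  set_fun X Y (polymap f) -> set_fun (zclosure X) (zclosure Y) (polymap f).
Proof.
move=> XY; apply: (zclosure_min (zclosed_preimage _ (zclosed_closure _))).
by move=> x /XY /(@sub_zclosure _ _ _).
Qed.

(** Being fixed by the composite is a polynomial condition, so isomorphisms of closures need only be
    checked on dense subsets. *)
Lemma zclosure_cancel (K : fieldType) (m n : nat) (f : 'I_n -> {mpoly K[m]})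
    (g : 'I_m -> {mpoly K[n]}) (X : set 'rV[K]_m) :
  {in X, cancel (polymap f) (polymap g)} ->
  {in zclosure X, cancel (polymap f) (polymap g)}.
Proof.
move=> fgK x; rewrite inE; move: x.
apply: (@zclosure_min _ _ _ [set x | polymap g (polymap f x) = x]); last first.
  by move=> x Xx /=; apply: fgK; rewrite inE.
exists [set (g i \mPo [tuple f j | j < n]) - 'X_i | i in setT].
apply/seteqP; split=> x /=.
  move=> xfg _ [i _ <-].
  by rewrite mevalB mevalXU -meval_polymap -[in X in _ - X]xfg mxE subrr.
move=> Sx; apply/rowP=> i; rewrite mxE meval_polymap; apply/eqP.
by rewrite -subr_eq0 -(mevalXU (x 0) i) -mevalB Sx //; exists i.
Qed.

Lemma zisomorphic_closure (K : fieldType) (m n : nat)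
    (f : 'I_n -> {mpoly K[m]}) (g : 'I_m -> {mpoly K[n]})
    (X : set 'rV[K]_m) (Y : set 'rV[K]_n) :
  set_fun X Y (polymap f) -> set_fun Y X (polymap g) ->
  {in X, cancel (polymap f) (polymap g)} ->
  {in Y, cancel (polymap g) (polymap f)} ->
  zisomorphic (zclosure X) (zclosure Y).
Proof.
move=> fXY gYX fgK gfK; exists f, g.
by split; [exact: zclosure_polymap|exact: zclosure_polymap|
  exact: zclosure_cancel|exact: zclosure_cancel].
Qed.

Lemma zisomorphic_sym (K : fieldType) (m n : nat)
    (Z : set 'rV[K]_m) (W : set 'rV[K]_n) :
  zisomorphic Z W -> zisomorphic W Z.
Proof. by move=> [f [g [*]]]; exists g, f. Qed.

Lemma polymap_comp (K : fieldType) (k m n : nat) (f : 'I_n -> {mpoly K[m]})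
    (g : 'I_m -> {mpoly K[k]}) (x : 'rV[K]_k) :
  polymap f (polymap g x) = polymap (fun i => f i \mPo [tuple g j | j < m]) x.
Proof. by apply/rowP=> i; rewrite !mxE meval_polymap. Qed.

Lemma zisomorphic_trans (K : fieldType) (k m n : nat)
    (Z : set 'rV[K]_k) (W : set 'rV[K]_m) (V : set 'rV[K]_n) :
  zisomorphic Z W -> zisomorphic W V -> zisomorphic Z V.
Proof.
move=> [f [g [fZ gW fgK gfK]]] [f' [g' [fW gV fgK' gfK']]].
exists (fun i => f' i \mPo [tuple f j | j < m]).
exists (fun i => g i \mPo [tuple g' j | j < m]); split=> x.
- by move=> Zx /=; rewrite -polymap_comp; apply: fW; exact: fZ.
- by move=> Vx /=; rewrite -polymap_comp; apply: gW; exact: gV.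
- move=> Zx; rewrite -!polymap_comp fgK' ?fgK // inE; apply: fZ.
  by rewrite inE in Zx.
- move=> Vx; rewrite -!polymap_comp gfK ?gfK' // inE; apply: gV.
  by rewrite inE in Vx.
Qed.

Lemma zirreducible_image (K : fieldType) (m n : nat)
    (f : 'I_n -> {mpoly K[m]}) (Z : set 'rV[K]_m) :
  zirreducible Z -> zirreducible (polymap f @` Z).
Proof.
move=> [[z Zz] irrZ]; split; first by exists (polymap f z), z.
move=> A B cA cB ZAB.
have [|||ZA|ZB] := irrZ (polymap f @^-1` A) (polymap f @^-1` B).
- exact: zclosed_preimage.
- exact: zclosed_preimage.
- by move=> x Zx; apply: ZAB; exists x.
- by left=> _ [x /ZA ? <-].
- by right=> _ [x /ZB ? <-].
Qed.

Lemma zisomorphic_irreducible (K : fieldType) (m n : nat)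
    (Z : set 'rV[K]_m) (W : set 'rV[K]_n) :
  zisomorphic Z W -> zirreducible Z -> zirreducible W.
Proof.
move=> [f [g [fZ gW fgK gfK]]] /(zirreducible_image f).
suff -> : polymap f @` Z = W by [].
apply/seteqP; split=> [_ [x Zx <-]|y Wy]; first exact: fZ.
by exists (polymap g y); [exact: gW|rewrite gfK ?inE].
Qed.

(** The image of a member of the chain is closed because it is the part of [W] that [g] sends into
    that member; injectivity keeps the inclusions strict. *)
Lemma zisomorphic_chain (K : fieldType) (m n : nat)
    (Z : set 'rV[K]_m) (W : set 'rV[K]_n) (d : nat) (C : nat -> set 'rV[K]_m) :
  zisomorphic Z W -> zclosed W -> zchain Z d C -> exists C', zchain W d C'.
Proof.
move=> [f [g [fZ gW fgK gfK]]] cW [irrC ltC].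
exists (fun i => polymap f @` C i); split=> i id.
  have [cC iC CZ] := irrC i id; split.
  - suff -> : polymap f @` C i = W `&` polymap g @^-1` C i.
      by apply: zclosedI => //; exact: zclosed_preimage.
    apply/seteqP; split=> [_ [x Cx <-]|y [Wy Cy]].
      by have Zx := CZ _ Cx; split=> /=; [exact: fZ|rewrite fgK ?inE].
    by exists (polymap g y) => //; rewrite gfK ?inE.
  - exact: zirreducible_image.
  - by move=> _ [x /CZ/fZ ? <-].
have [_ _ CZ] := irrC i (ltnW id); have [_ _ CZ'] := irrC i.+1 id.
have [sub nsub] := ltC i id; split.
  by move=> _ [x Cx <-]; exists x => //; exact: sub.
move=> sub'; apply: nsub => x Cx.
have [y Cy fyx] : (polymap f @` C i) (polymap f x) by apply: sub'; exists x.
by rewrite -(fgK x) ?inE -?fyx ?fgK ?inE //; [exact: CZ|exact: CZ'].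
Qed.

Lemma zisomorphic_zdim (K : fieldType) (m n : nat)
    (Z : set 'rV[K]_m) (W : set 'rV[K]_n) (d : nat) :
  zclosed Z -> zclosed W -> zisomorphic Z W -> has_zdim Z d -> has_zdim W d.
Proof.
move=> cZ cW ZW [[C chC] maxd]; split.
  exact: zisomorphic_chain ZW cW chC.
move=> e C' /(zisomorphic_chain (zisomorphic_sym ZW) cZ) [C'' /maxd] //.
Qed.

Definition linpoly (K : fieldType) (m n : nat) (P : 'M[K]_(m, n)) (i : 'I_n) :
  {mpoly K[m]} := \sum_j P j i *: 'X_j.

Lemma polymap_lin (K : fieldType) (m n : nat) (P : 'M[K]_(m, n))
    (x : 'rV[K]_m) : polymap (linpoly P) x = x *m P.
Proof.
apply/rowP=> i; rewrite !mxE raddf_sum; apply: eq_bigr => j _.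
by rewrite /= mevalZ mevalXU mulrC.
Qed.

(** * Toric varieties *)

Definition lmon (K : fieldType) (d : nat) (x : 'rV[K]_d) (g : 'rV[int]_d) : K :=
  \prod_j x 0 j ^ g 0 j.

(* Elsewhere the junk value [0^-1 = 0] breaks the laws of exponents. *)
Definition mono_dom (K : fieldType) (m d : nat) (A : 'M[int]_(m, d)) :
  set 'rV[K]_d := [set x | forall j, x 0 j != 0 \/ forall i, 0 <= A i j].

(** The row vector [b A]: the exponent of the Laurent monomial to which the monomial of exponent [b]
    pulls back under [monomial_map A]. *)
Definition mnm_weight (m d : nat) (A : 'M[int]_(m, d)) (b : 'X_{1..m}) :
  'rV[int]_d := \row_j \sum_i A i j *+ b i.

Lemma prod_exprz (K : fieldType) (I : eqType) (r : seq I) (a : I -> int) (x : K) :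
  x != 0 \/ (forall i, 0 <= a i) ->
  \prod_(i <- r) x ^ a i = x ^ (\sum_(i <- r) a i).
Proof.
move=> xa; elim: r => [|i r IHr]; first by rewrite !big_nil.
rewrite !big_cons IHr; case: xa => [x0|a0]; first by rewrite expfzDr.
by rewrite exprzD_ss // a0 sumr_ge0.
Qed.

Lemma prod_monomial_map (K : fieldType) (m d : nat) (A : 'M[int]_(m, d))
    (x : 'rV[K]_d) (b : 'X_{1..m}) :
  mono_dom A x ->
  \prod_i monomial_map A x 0 i ^+ b i = lmon x (mnm_weight A b).
Proof.
move=> Ax; transitivity (\prod_i \prod_j x 0 j ^ (A i j *+ b i)).
  apply: eq_bigr => i _; rewrite mxE -prodrXl; apply: eq_bigr => j _.
  by rewrite exprnP exprz_exp -mulr_natr natz.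
rewrite exchange_big; apply: eq_bigr => j _ /=; rewrite mxE prod_exprz //.
by case: (Ax j) => [|A0]; [left|right => i; rewrite mulrn_wge0].
Qed.

Lemma meval_monomial_map (K : fieldType) (m d : nat) (A : 'M[int]_(m, d))
    (x : 'rV[K]_d) (f : {mpoly K[m]}) :
  mono_dom A x ->
  f.@[monomial_map A x 0] =
  \sum_(b <- msupp f) f@_b * lmon x (mnm_weight A b).
Proof.
by move=> Ax; rewrite mevalE; apply: eq_bigr => b _; rewrite prod_monomial_map.
Qed.

Definition torus (K : fieldType) (d : nat) : set 'rV[K]_d :=
  [set x | forall j, x 0 j != 0].

Lemma torus_mono_dom (K : fieldType) (m d : nat) (A : 'M[int]_(m, d)) :
  @torus K d `<=` mono_dom A.
Proof. by move=> x Tx j; left. Qed.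

(** In characteristic zero the [size p] integers starting at [L] are distinct roots, one more than
    the degree allows. *)
Lemma poly_nat_roots (K : numFieldType) (p : {poly K}) (L : nat) :
  (forall n, (L <= n)%N -> p.[n%:R] = 0) -> p = 0.
Proof.
move=> pL; apply/eqP; apply: contraT => p0.
have := @max_poly_roots _ p [seq i%:R | i <- iota L (size p)] p0.
rewrite size_map size_iota ltnn; apply.
  by apply/allP=> _ /seq.mapP[i + ->]; rewrite mem_iota => /andP[Li _]; apply/eqP/pL.
by rewrite map_inj_uniq ?iota_uniq //; exact: mulrIn (oner_neq0 _).
Qed.

(* Two nonvanishing loci in the torus meet already on the line joining a point
   of each. *)
Lemma torus_mul (K : numFieldType) (d : nat) (F G : {mpoly K[d]}) :
  (forall x, torus x -> F.@[x 0] = 0 \/ G.@[x 0] = 0) ->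
  (forall x, @torus K d x -> F.@[x 0] = 0) \/
  (forall x, @torus K d x -> G.@[x 0] = 0).
Proof.
move=> FG; apply: contrapT => /not_orP[/existsNP[x /not_implyP[Tx Fx]]].
move=> /existsNP[y /not_implyP[Ty Gy]].
pose l j : {poly K} := (x 0 j)%:P + 'X * (y 0 j - x 0 j)%:P.
pose P (H : {mpoly K[d]}) : {poly K} := mmap polyC l H.
pose z s : 'rV[K]_d := x + s *: (y - x).
have PE H s : (P H).[s] = H.@[z s 0].
  rewrite /P mevalE /mmap horner_sum; apply: eq_bigr => b _.
  rewrite hornerM hornerC /mmap1 horner_prod; congr (_ * _).
  apply: eq_bigr => j _; rewrite horner_exp /l /z !mxE; congr (_ ^+ _).
  by rewrite hornerD hornerM !hornerC hornerX.
have z0 : z 0 = x by rewrite /z scale0r addr0.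
have z1 : z 1 = y by rewrite /z scale1r addrC subrK.
have PF : P F != 0 by apply/eqP => PF; apply: Fx; rewrite -z0 -PE PF horner0.
have PG : P G != 0 by apply/eqP => PG; apply: Gy; rewrite -z1 -PE PG horner0.
(* [H] vanishes exactly off the torus, so it takes care of the points where the line leaves the
   torus. *)
pose H : {mpoly K[d]} := \prod_j 'X_j.
have PH : P H != 0.
  apply/eqP => PH; suff /eqP : H.@[x 0] = 0.
    by rewrite rmorph_prod /=; under eq_bigr do rewrite mevalXU;
      rewrite prodf_seq_eq0 => /hasP[j _ /=]; apply/negP/Tx.
  by rewrite -z0 -PE PH horner0.
have : P F * P G * P H = 0.
  apply: (@poly_nat_roots _ _ 0) => n _; rewrite !hornerM !PE.
  have [/FG[->|->]|] := pselect (torus (z n%:R)); rewrite ?(mul0r, mulr0) //.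
  move=> /existsNP[j /negP]; rewrite negbK => zj.
  rewrite [X in _ * X](_ : _ = 0) ?mulr0 //.
  rewrite rmorph_prod /=; apply/eqP; rewrite prodf_seq_eq0; apply/hasP.
  by exists j; rewrite ?mem_index_enum //= mevalXU.
by apply/eqP; rewrite !mulf_neq0.
Qed.

Lemma laurent_clear (K : fieldType) (d : nat) (I : eqType) (r : seq I)
    (c : I -> K) (g : I -> 'rV[int]_d) :
  exists (F : {mpoly K[d]}) (C : nat), forall x, @torus K d x ->
    (\sum_(i <- r) c i * lmon x (g i)) * (\prod_j x 0 j) ^+ C = F.@[x 0].
Proof.
elim: r => [|i r [F [C FC]]].
  by exists 0, 0%N => x _; rewrite big_nil mul0r meval0.
(* [N] bounds the exponents of the new term in absolute value, so multiplying by the [N]-th power of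
   all coordinates clears its denominators. *)
pose N := (\sum_j `|(g i 0 j)%R|)%N.
pose G : {mpoly K[d]} := c i *: \prod_j 'X_j ^+ `|(g i 0 j + N%:Z)%R|%N.
exists (G * \prod_j 'X_j ^+ C + F * \prod_j 'X_j ^+ N), (N + C)%N => x Tx.
rewrite big_cons mevalD !mevalM -FC // mulrDl exprD !rmorph_prod /=.
have XE (k : nat) :
    \prod_j ('X_j ^+ k : {mpoly K[d]}).@[x 0] = (\prod_j x 0 j) ^+ k.
  by rewrite -prodrXl; apply: eq_bigr => j _; rewrite rmorphXn /= mevalXU.
rewrite !XE mulrA; congr (_ * _ + _); last by rewrite mulrA mulrAC.
rewrite mevalZ -mulrA rmorph_prod /= -prodrXl /lmon -big_split /=.
congr (_ * _); apply: eq_bigr => j _; rewrite rmorphXn /= mevalXU.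
have gN : 0 <= g i 0 j + N%:Z.
  rewrite -lerBlDr sub0r lerNl (le_trans (ler_norm _)) // normrN -abszE lez_nat.
  by rewrite /N (bigD1 j) ?leq_addr.
by rewrite [RHS]exprnP gez0_abs // expfzDr //; exact: Tx.
Qed.

(** Pulled back to the torus and cleared of denominators, polynomials on the image become
    polynomials on the torus with the same zeros; [torus_mul] then gives the primality needed. *)
Lemma toricY_irreducible (K : numFieldType) (m d : nat) (A : 'M[int]_(m, d)) :
  zirreducible (@toricY K m d A).
Proof.
apply: zirreducible_closure => [|f g fg].
  exists (monomial_map A (const_mx 1)), (const_mx 1) => //= j.
  by rewrite mxE oner_eq0.
have clear (h : {mpoly K[m]}) : exists H : {mpoly K[d]}, forall x, torus x ->
    (h.@[monomial_map A x 0] = 0 <-> H.@[x 0] = 0).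
  have [H [C HC]] := laurent_clear (msupp h) (fun b => h@_b) (mnm_weight A).
  exists H => x Tx; rewrite -HC // -meval_monomial_map; last exact: torus_mono_dom.
  split=> [->|/eqP]; first by rewrite mul0r.
  rewrite mulf_eq0 expf_eq0 => /orP[/eqP //|/andP[_]].
  by rewrite prodf_seq_eq0 => /hasP[j _ /=]; rewrite (negPf (Tx j)).
have [F fF] := clear f; have [G gG] := clear g.
have [x Tx|Ff|Gg] := @torus_mul _ _ F G.
- have [/(fF _ Tx)|/(gG _ Tx)] := fg _ (ex_intro2 _ _ x Tx erefl); by [left|right].
- by left=> _ [x Tx <-]; apply/fF => //; exact: Ff.
- by right=> _ [x Tx <-]; apply/gG => //; exact: Gg.
Qed.

(** * Dimension of toric varieties *)

Definition zindep (K : fieldType) (n : nat) (Z : set 'rV[K]_n) (T : finType)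
    (b : T -> {mpoly K[n]}) : Prop :=
  forall c : T -> K, (forall x, Z x -> \sum_t c t * (b t).@[x 0] = 0) ->
  forall t, c t = 0.

(** Restricting a relation to [Z] leaves only the terms with [f ^+ 0], whose coefficients vanish by
    independence on [Z]. The rest is a multiple of [f], and [f] cancels because [W] is
    irreducible. *)
Lemma zindep_powers (K : fieldType) (n : nat) (Z W : set 'rV[K]_n)
    (T : finType) (b : T -> {mpoly K[n]}) (f : {mpoly K[n]}) (D : nat) :
  Z `<=` W -> zirreducible W -> zindep Z b ->
  (forall x, Z x -> f.@[x 0] = 0) -> ~ (forall x, W x -> f.@[x 0] = 0) ->
  zindep W (fun p : 'I_D * T => f ^+ p.1 * b p.2).
Proof.
move=> ZW irrW ib fZ fW.
(* Coefficients indexed by [nat] instead of ['I_D] can be shifted in the induction. *)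
suff main (c : nat -> T -> K) :
    (forall x, W x -> \sum_(k < D) f.@[x 0] ^+ k *
        (\sum_t c k t * (b t).@[x 0]) = 0) ->
    forall k t, (k < D)%N -> c k t = 0.
  move=> c cW [k t].
  pose c' (k : nat) (t : T) := if insub k is Some i then c (i, t) else 0.
  have cE i s : c' (val i) s = c (i, s) by rewrite /c' valK.
  rewrite -cE main ?ltn_ord // => x Wx; rewrite -[RHS](cW x Wx).
  under [in LHS]eq_bigr do rewrite big_distrr /=.
  rewrite pair_big /=; apply: eq_bigr => -[i s] _ /=.
  by rewrite mevalM rmorphXn /= cE mulrCA.
elim: D c => [|D IHD] c cW k t; first by rewrite ltn0.
have c0 s : c 0%N s = 0.
  apply: ib => x Zx; have := cW x (ZW x Zx).
  rewrite big_ord_recl expr0 mul1r [X in _ + X]big1 ?addr0 // => i _.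
  by rewrite fZ // expr0n mul0r.
case: k => [//|k]; rewrite ltnS.
apply: (IHD (fun k => c k.+1)) => x.
pose g : {mpoly K[n]} := \sum_(k < D) f ^+ k * (\sum_t c k.+1 t *: b t).
have gE (y : 'rV[K]_n) : g.@[y 0] =
    \sum_(k < D) f.@[y 0] ^+ k * (\sum_t c k.+1 t * (b t).@[y 0]).
  rewrite raddf_sum; apply: eq_bigr => i _ /=.
  rewrite mevalM rmorphXn raddf_sum; congr (_ * _); apply: eq_bigr => s _ /=.
  by rewrite mevalZ.
rewrite -gE; move: x; case: (@zirreducible_mul _ _ W f g) => // x Wx.
rewrite mevalM gE -[RHS](cW x Wx) big_ord_recl expr0 mul1r.
rewrite [X in _ = X + _]big1 ?add0r; last by move=> s _; rewrite c0 mul0r.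
rewrite mulr_sumr; by apply: eq_bigr => i _; rewrite mulrA -exprS.
Qed.

Lemma msizeM_leq (K : fieldType) (n : nat) (p q : {mpoly K[n]}) :
  (msize (p * q) <= msize p + msize q)%N.
Proof.
have [->|p0] := eqVneq p 0; first by rewrite mul0r msize0.
have [->|q0] := eqVneq q 0; first by rewrite mulr0 msize0.
by rewrite msizeM // leq_pred.
Qed.

Lemma msizeX_leq (K : fieldType) (n : nat) (p : {mpoly K[n]}) (k : nat) :
  (msize (p ^+ k) <= k * msize p + 1)%N.
Proof.
elim: k => [|k IHk]; first by rewrite expr0 msize1.
by rewrite exprS mulSn -addnA (leq_trans (msizeM_leq _ _)) ?leq_add2l.
Qed.

Lemma zchain_sub (K : fieldType) (n d : nat) (X : set 'rV[K]_n)
    (C : nat -> set 'rV[K]_n) (i j : nat) :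
  zchain X d C -> (i <= j)%N -> (j <= d)%N -> C i `<=` C j.
Proof.
move=> [_ ltC]; elim: j => [|j IHj]; first by rewrite leqn0 => /eqP -> _ x.
rewrite leq_eqVlt => /orP[/eqP-> _ x //|]; rewrite ltnS => ij jd.
have [sub _] := ltC j jd; exact: subset_trans (IHj ij (ltnW jd)) sub.
Qed.

(* Along a strict chain of irreducible closed sets, each step provides one more
   algebraically independent function: the box monomials of side [D] in these
   functions are linearly independent, of degree linear in [D]. *)
Lemma zchain_indep (K : fieldType) (n d : nat) (X : set 'rV[K]_n)
    (C : nat -> set 'rV[K]_n) :
  zchain X d C ->
  exists S : nat, forall D : nat, exists (T : finType) (b : T -> {mpoly K[n]}),
    [/\ #|T| = (D ^ d)%N, zindep (C d) b &
        forall t, (msize (b t) <= S * D + S)%N].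
Proof.
move=> chC; have [irrC ltC] := chC.
have : (d <= d)%N by [].
elim: {1 3 4}d => [|e IHe] ed.
  exists 1%N => D; exists unit, (fun => 1); split=> [|c|_].
  - by rewrite card_unit expn0.
  - have [_ [[x Cx] _] _] := irrC 0%N (leq0n _).
    by move=> /(_ x Cx); rewrite (bigD1 tt) // big1 => [|[]//];
      rewrite /= meval1 mulr1 addr0 => cx [].
  - by rewrite msize1 addn1.
have [S HS] := IHe (ltnW ed).
have [sub nsub] := ltC e ed.
have [[Q eQ] _ _] := irrC e (ltnW ed).
have [f fZ fW] : exists2 f : {mpoly K[n]}, (forall x, C e x -> f.@[x 0] = 0) &
    ~ (forall x, C e.+1 x -> f.@[x 0] = 0).
  apply: contrapT => nf; apply: nsub => x Cx; rewrite eQ => f Qf.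
  apply: contrapT => fx; apply: nf; exists f; last by move/(_ x Cx).
  by move=> y; rewrite eQ; apply.
(* For [k < D] the size of [f ^+ k * b t] is at most [D * msize f + 1 + S * D + S]. *)
exists (S + msize f + 1)%N => D; have [T [b [cT ib sb]]] := HS D.
exists ('I_D * T)%type, (fun p : 'I_D * T => f ^+ p.1 * b p.2); split.
- by rewrite card_prod card_ord cT expnS.
- by have [_ irrW _] := irrC e.+1 ed; exact: zindep_powers sub irrW ib fZ fW.
- move=> [k t] /=; apply: (leq_trans (msizeM_leq _ _)).
  apply: (leq_trans (leq_add (msizeX_leq _ _) (sb t))).
  have : (k * msize f <= D * msize f)%N by rewrite leq_mul2r ltnW ?orbT.
  by lia.
Qed.

(** If [e > d], the [D ^ e] independent functions of [zchain_indep] pull back to combinations of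
    [(2 N + 1) ^ d] Laurent monomials, with [N] linear in [D]. For large [D] these are too few,
    which forces a linear relation. *)
Lemma toricY_chain_leq (K : fieldType) (m d e : nat) (A : 'M[int]_(m, d))
    (C : nat -> set 'rV[K]_m) : zchain (toricY A) e C -> (e <= d)%N.
Proof.
move=> chC; rewrite leqNgt; apply/negP => de.
have [S HS] := zchain_indep chC.
pose a := (\sum_i \sum_j `|(A i j)%R|)%N.
(* As [D] is positive, [N <= 2 * S * D * a], so [2 * N + 1 <= B * D]; and [D > B ^ d] makes
   [(B * D) ^ d < D ^ d.+1]. *)
pose B := (4 * S * a + 1)%N; pose D := (B ^ d).+1.
pose N := ((S * D + S) * a)%N.
have [T [b [cT ib sb]]] := HS D.
pose box : finType := {ffun 'I_d -> 'I_(2 * N).+1}.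
pose gam (g : box) : 'rV[int]_d := \row_j ((g j)%:Z - N%:Z).
have cB : (#|box| < #|T|)%N.
  rewrite card_ffun !card_ord cT.
  have NB : ((2 * N).+1 <= B * D)%N by rewrite /N /B /D; nia.
  apply: (@leq_ltn_trans ((B * D) ^ d)); first by case: (d) => // k; rewrite leq_exp2r.
  apply: (@leq_trans (D ^ d.+1)); last by rewrite leq_pexp2l.
  by rewrite expnMn expnS ltn_pmul2r ?expn_gt0.
have wgam t bt : bt \in msupp (b t) -> exists g, mnm_weight A bt = gam g.
  move=> /msize_mdeg_lt /leq_trans /(_ (sb t)) lt_bt.
  have bnd j : `|mnm_weight A bt 0 j| <= N%:Z.
    rewrite mxE (le_trans (ler_norm_sum _ _ _)) //.
    apply: (@le_trans _ _ (\sum_(i < m) (mdeg bt * `|A i j|)%:Z)).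
      apply: ler_sum => i _; rewrite normrMn -abszE -mulr_natl PoszM natz.
      by rewrite ler_wpM2r // lez_nat mdegE (bigD1 i) ?leq_addr.
    rewrite -(big_morph Posz PoszD (erefl _)) lez_nat -big_distrr /=.
    rewrite leq_mul //; first exact: ltnW.
    by apply: leq_sum => i _; rewrite (bigD1 j) ?leq_addr.
  have gN j : (`|(mnm_weight A bt 0 j + N%:Z)%R| < (2 * N).+1)%N.
    by have := bnd j; lia.
  exists [ffun j => Ordinal (gN j)]; apply/rowP => j; rewrite [RHS]mxE ffunE /=.
  by have := bnd j; lia.
have gam_inj : injective gam.
  move=> g h /rowP gh; apply/ffunP => j; apply/val_inj => /=.
  by have := gh j; rewrite !mxE => /addIr [].
(* Row [t] holds the coefficients of the pullback of [b t]. There are more rows than columns, so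
   some nonzero [c] in the left kernel is a relation between the pullbacks. *)
pose v := \matrix_(t < #|T|, g < #|box|)
  \sum_(bt <- msupp (b (enum_val t)) | mnm_weight A bt == gam (enum_val g))
     (b (enum_val t))@_bt.
have : kermx v != 0.
  by rewrite kermx_eq0 /row_free ltn_eqF // (leq_ltn_trans (rank_leq_col _)).
case/rowV0Pn => c /sub_kermxP cv /eqP; apply; apply/rowP => t.
rewrite [RHS]mxE -[t]enum_valK; move: (enum_val t) => {}t.
move: t; apply: ib => y Cy.
have {Cy} : toricY A y.
  by have [irrC _] := chC; have [_ _ sC] := irrC e (leqnn e); exact: sC.
pose p : {mpoly K[m]} := \sum_t c 0 (enum_rank t) *: b t.
have pE (z : 'rV[K]_m) : p.@[z 0] = \sum_t c 0 (enum_rank t) * (b t).@[z 0].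
  by rewrite raddf_sum; apply: eq_bigr => t _ /=; rewrite mevalZ.
rewrite -pE => /zclosureP; apply => _ [x Tx <-]; rewrite pE.
have bE t : (b t).@[monomial_map A x 0] =
    \sum_g v (enum_rank t) g * lmon x (gam (enum_val g)).
  rewrite meval_monomial_map; last exact: torus_mono_dom.
  transitivity (\sum_(bt <- msupp (b t)) \sum_(g < #|box|)
      if mnm_weight A bt == gam (enum_val g)
      then (b t)@_bt * lmon x (gam (enum_val g)) else 0).
    apply: eq_big_seq => bt /wgam [g ->].
    rewrite (bigD1 (enum_rank g)) //= enum_rankK eqxx big1 ?addr0 // => h hg.
    by case: eqP => // /gam_inj gh; rewrite gh enum_valK eqxx in hg.
  rewrite exchange_big; apply: eq_bigr => g _ /=.
  by rewrite -big_mkcond mxE enum_rankK mulr_suml.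
under eq_bigr do rewrite bE mulr_sumr.
rewrite exchange_big big1 // => g _ /=.
transitivity ((c *m v) 0 g * lmon x (gam (enum_val g))); last first.
  by rewrite cv mxE mul0r.
rewrite mxE mulr_suml (reindex_onto enum_rank enum_val) /=; last first.
  by move=> t _; rewrite enum_valK.
by apply: eq_big => [t|t _]; rewrite ?enum_rankK ?eqxx // mulrA.
Qed.

(** With [u] and [v] the positive and negative parts of [e], the equation becomes [y^u = z y^v]. *)
Lemma laurent_eq (K : fieldType) (m : nat) (e : 'rV[int]_m) (z : K) :
  exists p : {mpoly K[m]}, forall y, torus y ->
    (p.@[y 0] = 0 <-> lmon y e = z).
Proof.
pose s i := e 0 i.
pose u := [multinom if (0 <= s i)%R then `|s i|%N else 0%N | i < m].
pose v := [multinom if (0 <= s i)%R then 0%N else `|s i|%N | i < m].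
exists ('X_[u] - z *: 'X_[v]) => y Ty.
rewrite mevalB mevalZ !mevalX.
have v0 : \prod_i y 0 i ^+ v i != 0.
  by apply/prodf_neq0 => i _; rewrite expf_neq0 ?Ty.
have -> : \prod_i y 0 i ^+ u i = lmon y e * \prod_i y 0 i ^+ v i.
  rewrite -big_split; apply: eq_bigr => i _ /=; rewrite !mnmE /s.
  case: ifPn => [e0|]; first by rewrite mulr1 exprnP gez0_abs.
  rewrite -ltNge => /ltW e0.
  by rewrite [in X in _ * X]exprnP lez0_abs // -expfzDr ?Ty // subrr.
rewrite -mulrBl; split=> [/eqP|->]; last by rewrite subrr mul0r.
by rewrite mulf_eq0 (negPf v0) orbF subr_eq0 => /eqP.
Qed.

Lemma lmon_monomial_map (K : fieldType) (m d : nat) (A : 'M[int]_(m, d))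
    (x : 'rV[K]_d) (e : 'rV[int]_m) :
  torus x -> lmon (monomial_map A x) e = lmon x (e *m A).
Proof.
move=> Tx; transitivity (\prod_i \prod_j x 0 j ^ (e 0 i * A i j)).
  apply: eq_bigr => i _; rewrite mxE; elim/big_rec2: _ => [|j a b _ <-].
    by rewrite exp1rz.
  by rewrite expfzMl exprz_exp [A i j * _]mulrC.
rewrite exchange_big; apply: eq_bigr => j _ /=.
by rewrite mxE prod_exprz //; left; exact: Tx.
Qed.

Lemma torus_monomial_map (K : fieldType) (m d : nat) (A : 'M[int]_(m, d))
    (x : 'rV[K]_d) : torus x -> torus (monomial_map A x).
Proof.
by move=> Tx i; rewrite mxE; apply/prodf_neq0 => j _; rewrite expfz_neq0 ?Tx.
Qed.

(** The left inverse expresses each torus coordinate as a Laurent monomial on the image. This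
    separates the members of the chain: [A_ i] parametrizes the image of the subtorus whose
    coordinates from index [i] on are 1. *)
Lemma toricY_zdim (K : numFieldType) (m d : nat) (A : 'M[int]_(m, d))
    (B : 'M[int]_(d, m)) : B *m A = 1%:M -> has_zdim (@toricY K m d A) d.
Proof.
move=> BA; split; last by move=> e C; exact: toricY_chain_leq.
pose A_ i : 'M[int]_(m, d) := \matrix_(k, j) if (j < i)%N then A k j else 0.
pose cut i (x : 'rV[K]_d) : 'rV[K]_d := \row_j if (j < i)%N then x 0 j else 1.
have cutT i x : torus x -> torus (cut i x).
  by move=> Tx j; rewrite mxE; case: ifP => // _; exact: oner_neq0.
have mapE i j x : (i <= j)%N ->
    monomial_map (A_ i) x = monomial_map (A_ j) (cut i x).
  move=> ij; apply/rowP=> k; rewrite !mxE; apply: eq_bigr => l _.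
  by rewrite !mxE; case: ifPn => [/leq_trans->//|]; rewrite exp1rz expr0z.
have Ad : A_ d = A by apply/matrixP=> k j; rewrite mxE ltn_ord.
have sub i j : (i <= j)%N -> toricY (A_ i) `<=` @toricY K m d (A_ j).
  move=> ij; apply: zclosureS => _ [x Tx <-]; exists (cut i x) => //=.
    exact: cutT.
  by rewrite -mapE.
exists (fun i => toricY (A_ i)); split=> i id.
  split; first exact: zclosed_closure.
    exact: toricY_irreducible.
  by rewrite -[in X in _ `<=` X]Ad; exact: sub.
split; first exact: sub.
have BAE j : (B *m A) (Ordinal id) j = (Ordinal id == j)%:R.
  by rewrite BA mxE.
have lmonE k (x : 'rV[K]_d) : torus x ->
    lmon (monomial_map (A_ k) x) (row (Ordinal id) B) =
    if (i < k)%N then x 0 (Ordinal id) else 1.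
  move=> Tx; rewrite lmon_monomial_map // /lmon (bigD1 (Ordinal id)) //= big1.
    rewrite mulr1 -row_mul mxE; have := BAE (Ordinal id).
    rewrite !mxE eqxx mulr1n => BAi; case: ifPn => ik.
      rewrite -[RHS]expr1z -[in RHS]BAi; congr (_ ^ _).
      by apply: eq_bigr => l _; rewrite mxE ik.
    by rewrite big1 ?expr0z // => l _; rewrite mxE (negPf ik) mulr0.
  move=> j ji; rewrite -row_mul mxE.
  have := BAE j; rewrite !mxE eq_sym (negPf ji) mulr0n => BAi.
  suff -> : \sum_l B (Ordinal id) l * A_ k l j = 0 by rewrite expr0z.
  have [jk|jk] := boolP (j < k)%N.
    by rewrite -[RHS]BAi; apply: eq_bigr => l _; rewrite mxE jk.
  by rewrite big1 // => l _; rewrite mxE (negPf jk) mulr0.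
(* The Laurent monomial given by row [i] of [B] is 1 on the image of the [i]-th subtorus, but 2 at
   the image of the all-2 point in the next member. *)
have [p pP] := @laurent_eq K m (row (Ordinal id) B) 1.
have T2 : torus (const_mx 2 : 'rV[K]_d) by move=> j; rewrite mxE pnatr_eq0.
move=> /(_ (monomial_map (A_ i.+1) (const_mx 2))) H.
have : p.@[monomial_map (A_ i.+1) (const_mx 2) 0] = 0.
  have /zclosureP : toricY (A_ i) (monomial_map (A_ i.+1) (const_mx 2 : 'rV[K]_d)).
    by apply: H; apply: sub_zclosure; exists (const_mx 2).
  apply=> _ [x Tx <-]; apply/pP; first exact: torus_monomial_map.
  by rewrite lmonE // ltnn.
move/pP => /(_ (torus_monomial_map _ T2)); rewrite lmonE // ltnSn mxE.
by move/eqP; rewrite -subr_eq0 -[X in _ - X]/(1%:R) -natrB // oner_eq0.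
Qed.

(** * Exponential polynomials *)

(** The shift preserves the degree and the leading coefficient, so the leading terms cancel. *)
Lemma size_comp_succ_sub (K : numFieldType) (q : {poly K}) (N : nat) :
  (size q <= N.+1)%N -> (size (q \Po ('X + 1%:P) - q)%R <= N)%N.
Proof.
have X1 : size ('X + 1%:P : {poly K}) = 2 by rewrite size_XaddC.
have sq : size (q \Po ('X + 1%:P)) = size q.
  by rewrite size_comp_poly2.
move=> qN; apply/leq_sizeP => j Nj; rewrite coefB.
have [jq|] := leqP (size q) j; first by rewrite !nth_default ?sq // subrr.
case def_q: (size q) qN => [//|k]; rewrite !ltnS => kN jk.
have {jk Nj} -> : j = (size q).-1 by rewrite def_q /=; lia.
rewrite -{1}sq -!lead_coefE lead_coef_comp ?X1 // lead_coefDl ?size_polyX.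
  by rewrite lead_coefX expr1n mulr1 subrr.
by rewrite size_polyC oner_eq0.
Qed.

(* The operator [u(n) |-> u(n+1) - m0 u(n)] lowers the degree of the coefficient of
   [m0 ^ n] and preserves the other degrees. *)
Lemma exp_poly_indep (K : numFieldType) (s : seq K) (q : K -> {poly K})
    (L : nat) :
  uniq s -> 0 \notin s ->
  (forall n, (L <= n)%N -> \sum_(m <- s) (q m).[n%:R] * m ^+ n = 0) ->
  {in s, forall m, q m = 0}.
Proof.
elim: s q => [//|m0 s IHs] q /andP[m0s us].
rewrite in_cons negb_or eq_sym => /andP[m00 s0].
have [N] := ubnP (size (q m0)); elim: N q => [//|N IHN] q.
rewrite ltnS => qN qs.
suff qs0 : {in s, forall m, q m = 0}.
  move=> m; rewrite in_cons => /orP[/eqP->|]; last exact: qs0.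
  apply: (@poly_nat_roots _ _ L) => n /qs; rewrite big_cons big_seq big1.
    by rewrite addr0 => /eqP; rewrite mulf_eq0 expf_eq0 (negPf m00) andbF orbF => /eqP.
  by move=> m' /qs0 ->; rewrite horner0 mul0r.
case: N => [|N] in IHN qN.
  apply: IHs => // n /qs; rewrite big_cons.
  by move: qN; rewrite leqn0 size_poly_eq0 => /eqP ->; rewrite horner0 mul0r add0r.
pose q' m := m *: (q m \Po ('X + 1%:P)) - m0 *: q m.
have q'0 : {in m0 :: s, forall m, q' m = 0}.
  apply: IHN => [|n Ln].
    rewrite /q' -scalerBr (leq_ltn_trans (size_scale_leq _ _)) // ltnS.
    exact: size_comp_succ_sub.
  transitivity (\sum_(m <- m0 :: s) (q m).[n.+1%:R] * m ^+ n.+1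
      - m0 * \sum_(m <- m0 :: s) (q m).[n%:R] * m ^+ n).
    rewrite mulr_sumr -sumrB; apply: eq_bigr => m _.
    rewrite /q' hornerD hornerN !hornerZ horner_comp !hornerE.
    by rewrite /= -natr1 exprS; ring.
  by rewrite !qs ?leqW // mulr0 subrr.
(* The leading coefficient of [q' m] is [m - m0] times that of [q m], and [m0] is not in [s]. *)
move=> m ms; have /eqP := q'0 m (mem_behead (ms : m \in behead (m0 :: s))).
rewrite /q' subr_eq0 => /eqP/(congr1 lead_coef).
rewrite !lead_coefZ lead_coef_comp ?size_XaddC // lead_coefDl ?size_polyX;
  last by rewrite size_polyC oner_eq0.
rewrite lead_coefX expr1n mulr1 => /eqP.
rewrite -subr_eq0 -mulrBl mulf_eq0 subr_eq0 lead_coef_eq0 => /orP[/eqP em|/eqP //].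
by rewrite -em ms in m0s.
Qed.

(** Terms of equal base are collected into the polynomial [q m], which is zero by [exp_poly_indep];
    its coefficient of degree [j] is [c (m, j)]. *)
Lemma exp_monomial_indep (K : numFieldType) (s : seq (K * nat))
    (c : K * nat -> K) (L : nat) :
  uniq s -> {in s, forall p, p.1 != 0} ->
  (forall n, (L <= n)%N ->
    \sum_(p <- s) c p * (p.1 ^+ n * n%:R ^+ p.2) = 0) ->
  {in s, forall p, c p = 0}.
Proof.
move=> us s0 sL [m j] ms.
pose q (m : K) : {poly K} := \sum_(p <- s | p.1 == m) c p *: 'X^(p.2).
have : q m = 0.
  have ms1 : m \in undup [seq p.1 | p <- s].
    by rewrite mem_undup; apply/seq.mapP; exists (m, j).
  move: m ms1 {ms}; apply: (@exp_poly_indep _ _ _ L) => [||n /sL sn].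
  - exact: undup_uniq.
  - by rewrite mem_undup; apply/seq.mapP => -[p /s0 /eqP p0 /esym].
  rewrite -[RHS]sn; under eq_bigr do rewrite horner_sum mulr_suml.
  under eq_bigr do rewrite big_mkcond.
  rewrite exchange_big; apply: eq_big_seq => p ps /=.
  rewrite (bigD1_seq p.1) ?undup_uniq //=; last first.
    by rewrite mem_undup; apply/seq.mapP; exists p.
  rewrite eqxx big1 ?addr0; first by rewrite hornerZ hornerXn -mulrA [_ * p.1 ^+ _]mulrC.
  by move=> m; rewrite eq_sym => /negPf ->.
move=> /(congr1 (coefp j)); rewrite /= coef0 coef_sum big_mkcond.
rewrite (bigD1_seq (m, j)) //= eqxx coefZ coefXn eqxx mulr1.
rewrite big1 ?addr0 // => -[m' j']; rewrite xpair_eqE /= => nmj.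
case: eqP nmj => //= _; rewrite coefZ coefXn eq_sym => /negPf ->.
by rewrite mulr0.
Qed.

(** * Powers of a matrix *)

Lemma exp_monomial_family_indep (K : numFieldType) (I : eqType) (s : seq I)
    (a : I -> K) (e : I -> nat) (c : I -> K) (L : nat) :
  uniq s -> {in s &, injective (fun i => (a i, e i))} ->
  {in s, forall i, a i != 0} ->
  (forall n, (L <= n)%N ->
    \sum_(i <- s) c i * (a i ^+ n * n%:R ^+ e i) = 0) ->
  {in s, forall i, c i = 0}.
Proof.
move=> us inj_ae a0 cL i si; pose f i := (a i, e i).
pose c' p := \sum_(i <- s | f i == p) c i.
have c'E j : j \in s -> c' (f j) = c j.
  move=> sj; rewrite /c' big_mkcond (bigD1_seq j) //= eqxx big_seq_cond big1 ?addr0 //.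
  move=> k /andP[sk /negPf kj]; case: eqP => // /(inj_ae _ _ sk sj) ekj.
  by rewrite ekj eqxx in kj.
rewrite -c'E //; have : f i \in [seq f j | j <- s] by rewrite map_f.
move: (f i); apply: (@exp_monomial_indep _ _ _ L) => [|_ /seq.mapP[j sj ->]|n /cL].
- by rewrite map_inj_in_uniq.
- exact: a0.
by rewrite big_map => cs; rewrite -[RHS]cs; apply: eq_big_seq => j /c'E ->.
Qed.

(* [\sum_i f_i i^j x^i] is [f] under [('X d/d'X)^j] evaluated at [x]. *)
Lemma coef_moment_eq0 (K : fieldType) (f : {poly K}) (x : K) (j N : nat) :
  ('X - x%:P) ^+ j.+1 %| f -> (size f <= N)%N ->
  \sum_(i < N) f`_i * (x ^+ i * i%:R ^+ j) = 0.
Proof.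
elim: j f N => [|j IHj] f N xf fN.
  under eq_bigr do rewrite expr0 mulr1.
  by rewrite -horner_coef_wide //; apply/rootP; rewrite -dvdp_XsubCl -[_ - _]expr1.
rewrite -[RHS](IHj ('X * f^`()) N.+1); last first.
- rewrite (leq_trans (size_polyMleq _ _)) // size_polyX /= ltnS.
  by rewrite (leq_trans (size_poly _ _)) // (leq_trans (leq_pred _)).
- have [g ->] := dvdpP _ _ xf.
  rewrite derivM deriv_exp derivXsubC mul1r -mulr_natr /=.
  by apply: dvdp_mull; apply: dvdp_add; apply: dvdp_mull; rewrite ?dvdp_mulIl ?dvdp_exp2l.
rewrite [RHS]big_ord_recr /= [X in _ = _ + X](_ : _ = 0).
  rewrite addr0; apply: eq_bigr => -[[|i] iN] _ /=.
    by rewrite coefXM /= expr0n mulr0 mulr0 mul0r.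
  by rewrite coefXM /= coef_deriv [_%:R ^+ j.+1]exprS -mulr_natr; ring.
rewrite coefXM; case: N fN => [|N] fN /=; first by rewrite mul0r.
by rewrite coef_deriv nth_default // mul0rn mul0r.
Qed.

(** The sequence [x^k k^j] solves the recurrence with characteristic polynomial [p]. After division
    by [x^k] the sum is a polynomial in [k], so its vanishing at natural numbers extends to negative
    [k]. *)
Lemma exp_monomial_recurrence (K : numFieldType) (p : {poly K}) (x : K)
    (j : nat) (k : int) :
  ('X - x%:P) ^+ j.+1 %| p -> x != 0 ->
  \sum_(i < size p) p`_i * (x ^ (k + i%:Z) * (k + i%:Z)%:~R ^+ j) = 0.
Proof.
move=> xp x0.
pose P : {poly K} := \sum_(i < size p) (p`_i * x ^+ i)%:P * ('X + i%:R%:P) ^+ j.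
have PE y : P.[y] = \sum_(i < size p) p`_i * x ^+ i * (y + i%:R) ^+ j.
  rewrite horner_sum; apply: eq_bigr => i _.
  by rewrite hornerM hornerC horner_exp hornerD hornerX hornerC.
have P0 : P = 0.
  apply: (@poly_nat_roots _ _ 0) => n _; rewrite PE.
  apply: (mulfI (expf_neq0 n x0)); rewrite mulr0.
  rewrite -[RHS](@coef_moment_eq0 _ (p * 'X^n) x j (n + size p)).
  - rewrite big_split_ord /= [X in _ = X + _]big1 ?add0r; last first.
      by move=> i _; rewrite coefMXn ltn_ord mul0r.
    rewrite mulr_sumr; apply: eq_bigr => i _.
    by rewrite coefMXn ltnNge leq_addr /= addKn natrD exprD; ring.
  - exact: dvdp_mulr.
  - by rewrite (leq_trans (size_polyMleq _ _)) // size_polyXn addnS addnC.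
transitivity (x ^ k * P.[k%:~R]); last by rewrite P0 horner0 mulr0.
rewrite PE mulr_sumr; apply: eq_bigr => i _.
by rewrite expfzDr // intrD -exprnP; ring.
Qed.

(** The nonzero top coefficient propagates zeros upwards, the nonzero constant coefficient
    downwards. *)
Lemma recurrence_eq0 (K : fieldType) (V : lmodType K) (d : nat) (p : nat -> K)
    (S : int -> V) :
  p 0%N != 0 -> p d != 0 ->
  (forall k : int, \sum_(i < d.+1) p i *: S (k + i%:Z) = 0) ->
  (forall i : nat, (i < d)%N -> S i%:Z = 0) -> forall k, S k = 0.
Proof.
move=> p0 pd Srec S0.
have Spos (n : nat) : S n%:Z = 0.
  have [N] := ubnP n; elim: N n => [//|N IHN] n; rewrite ltnS => nN.
  have [/S0 //|dn] := ltnP n d.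
  have := Srec (n - d)%N%:Z; rewrite big_ord_recr /= big1 ?add0r.
    by rewrite -PoszD subnK // => /eqP; rewrite scaler_eq0 (negPf pd) => /eqP.
  by move=> i _; rewrite -PoszD IHN ?scaler0 //; have := ltn_ord i; lia.
have Sneg (n : nat) (k : int) : - n%:Z <= k -> S k = 0.
  elim: n k => [|n IHn] k; first by case: k => [k _|//]; exact: Spos.
  move=> nk; have [nk'|nk'] := leP (- n%:Z) k; first exact: IHn.
  have := Srec k; rewrite big_ord_recl /= addr0 big1 ?addr0.
    by move=> /eqP; rewrite scaler_eq0 (negPf p0) => /eqP.
  by move=> i _; rewrite IHn ?scaler0 //= /bump /=; lia.
by move=> k; apply: (Sneg `|k|%N); lia.
Qed.

(** Over all positions, the pairs of an entry and its [occ] list each entry [x] with every [j] below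
    the multiplicity of [x]. *)
Definition occ (T : eqType) (x0 : T) (r : seq T) (i : nat) : nat :=
  count_mem (nth x0 r i) (take i r).

Lemma occ_lt (T : eqType) (x0 : T) (r : seq T) (i : nat) :
  (i < size r)%N -> (occ x0 r i < count_mem (nth x0 r i) r)%N.
Proof.
move=> ir; rewrite /occ -[X in (_ < count _ X)%N](cat_take_drop i r) count_cat.
by rewrite -[X in (X < _)%N]addn0 ltn_add2l (drop_nth x0) //= eqxx.
Qed.

Lemma occ_inj (T : eqType) (x0 : T) (r : seq T) (i j : nat) :
  (i < size r)%N -> (j < size r)%N ->
  nth x0 r i = nth x0 r j -> occ x0 r i = occ x0 r j -> i = j.
Proof.
wlog ij : i j / (i < j)%N.
  move=> H ir jr e1 e2; have [ij|ji|//] := ltngtP i j; first exact: H.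
  by apply/esym/H.
move=> ir jr rij /eqP; rewrite ltn_eqF // /occ -rij.
have {1}-> : take i r = take i (take j r) by rewrite take_takel // ltnW.
rewrite -[X in (_ < count _ X)%N](cat_take_drop i (take j r)) count_cat.
rewrite -[X in (X < _)%N]addn0 ltn_add2l (drop_nth x0) ?size_takel //; last exact: ltnW.
by rewrite nth_take //= eqxx.
Qed.

Lemma occ_index (T : eqType) (x0 : T) (r : seq T) (x : T) :
  x \in r -> occ x0 r (index x r) = 0%N.
Proof.
move=> xr; rewrite /occ nth_index //; apply/count_memPn.
by rewrite in_take // ltnn.
Qed.

(** In the shortest prefix with a repetition, the last entry has occurred exactly once before. *)
Lemma occ_eq1 (T : eqType) (x0 : T) (r : seq T) :
  ~~ uniq r -> exists2 i, (i < size r)%N & occ x0 r i = 1%N.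
Proof.
elim/last_ind: r => [//|r x IHr]; rewrite rcons_uniq negb_and negbK size_rcons.
have [ur|nur] := boolP (uniq r); last first.
  move=> _; have [i ir oi] := IHr nur; exists i; first exact: leqW.
  by rewrite /occ nth_rcons ir -cats1 takel_cat ?(ltnW ir).
rewrite orbF => xr; exists (size r) => //.
by rewrite /occ nth_rcons ltnn eqxx -cats1 take_size_cat // count_uniq_mem ?xr.
Qed.

Lemma horner_mx_sum (K : fieldType) (n : nat) (M : 'M[K]_n.+1) (p : {poly K}) :
  horner_mx M p = \sum_(i < size p) p`_i *: M ^+ i.
Proof.
rewrite -[in LHS](coefK p) poly_def raddf_sum; apply: eq_bigr => i _ /=.
by rewrite linearZ /= rmorphXn /= horner_mx_X.
Qed.

(* [lam] lists the roots of the minimal polynomial with multiplicity, and [e i]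
   counts the earlier occurrences of [lam i]. *)
Lemma powers_exp_monomials (K : numClosedFieldType) (n : nat)
    (M : 'M[K]_n.+1) :
  M \in unitmx ->
  exists (m : nat) (lam : 'I_m -> K) (e : 'I_m -> nat)
    (Q : 'M[K]_(m, (n.+1 * n.+1)%N)) (Q' : 'M[K]_((n.+1 * n.+1)%N, m)),
  [/\ Q *m Q' = 1%:M,
      forall k : int,
        mxvec (M ^ k) = (\row_i (lam i ^ k * k%:~R ^+ e i)) *m Q,
      forall i, lam i != 0 /\ eigenvalue M (lam i),
      forall a, eigenvalue M a -> exists2 i, lam i = a & e i = 0%N &
      if `[< diagonalizable M >] then forall i, e i = 0%N
      else exists i j, [/\ lam i = lam j, e i = 1%N & e j = 0%N]].
Proof.
move=> uM; pose p := mxminpoly M.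
have [r] := closed_field_poly_normal p.
have /monicP -> := mxminpoly_monic M; rewrite scale1r => pr.
have p_neq0 : p != 0 by rewrite monic_neq0 ?mxminpoly_monic.
have sr : size r = degree_mxminpoly M.
  by apply: succn_inj; rewrite -size_mxminpoly -/p pr size_prod_XsubC.
have rE a : (a \in r) = eigenvalue M a.
  by rewrite eigenvalue_root_min -/p pr root_prod_XsubC.
have mupE a : mup a p = count_mem a r by rewrite pr mu_prod_XsubC.
set d := degree_mxminpoly M in sr.
pose lam (i : 'I_d) := r`_i; pose e (i : 'I_d) := occ 0 r i.
have lamr i : lam i \in r by rewrite mem_nth // sr.
have r0 : 0 \notin r.
  rewrite rE; apply/eigenvalueP => -[v]; rewrite scale0r => vM v0.
  by move: v0; rewrite -[v](mulmxK uM) vM mul0mx eqxx.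
have lam0 i : lam i != 0 by apply: contraNneq r0 => <-.
have ae_inj : injective (fun i => (lam i, e i)).
  move=> i j [lij eij]; apply: val_inj.
  by apply: occ_inj lij eij; rewrite sr ltn_ord.
have lamp i : ('X - (lam i)%:P) ^+ (e i).+1 %| p.
  by rewrite -mup_geq // mupE occ_lt ?sr.
pose w (k : int) : 'rV[K]_d := \row_i (lam i ^ k * k%:~R ^+ e i).
have sp : size p = d.+1 by rewrite size_mxminpoly.
have p0 : p`_0 != 0.
  rewrite -horner_coef0; apply: contraNneq r0 => p0.
  by rewrite rE eigenvalue_root_min; apply/rootP.
have pd : p`_d != 0.
  by rewrite -[d]/(d.+1.-1) -sp -lead_coefE lead_coef_eq0.
have wrec (k : int) : \sum_(i < d.+1) p`_i *: w (k + i%:Z) = 0.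
  apply/rowP => l; rewrite summxE mxE -[RHS](exp_monomial_recurrence k (lamp l) (lam0 l)).
  by rewrite sp; apply: eq_bigr => i _; rewrite !mxE.
pose W : 'M[K]_d := \matrix_(i < d) w i%:Z.
(* A vector killed by the transpose of [W] is a combination of the sequences [lam_i^k k^(e i)] that
   vanishes for [k < d], hence for all [k] by the recurrence; independence of these sequences makes
   it zero. *)
have uW : W \in unitmx.
  rewrite -unitmx_tr -row_free_unit -kermx_eq0; apply/eqP/row_matrixP => i.
  rewrite row0; set u := row i _; have : u *m W^T = 0 by rewrite -row_mul mulmx_ker row0.
  move=> uW; clearbody u.
  pose S (k : int) : 'M[K]_1 := u *m (w k)^T.
  have S0 : forall k, S k = 0.
    apply: (@recurrence_eq0 _ _ d (fun i => p`_i) S p0 pd) => [k|j jd].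
      under eq_bigr do rewrite /S scalemxAr -linearZ /=.
      by rewrite -mulmx_sumr -linear_sum wrec linear0 mulmx0.
    apply/rowP=> l; rewrite ord1 [RHS]mxE.
    have := congr1 (fun v : 'rV_d => v 0 (Ordinal jd)) uW; rewrite [RHS]mxE => <-.
    by rewrite !mxE; apply: eq_bigr => l' _; rewrite !mxE.
  apply/rowP => l; rewrite [RHS]mxE.
  have := mem_index_enum l; move: l.
  apply: (@exp_monomial_family_indep _ _ _ lam e _ 0) => [||l _|k _].
  - exact: index_enum_uniq.
  - by move=> ? ? _ _; exact: ae_inj.
  - exact: lam0.
  have Sk : S k%:Z 0 0 = 0 by rewrite S0 mxE.
  by rewrite -[RHS]Sk [RHS]mxE; apply: eq_bigr => l _; rewrite !mxE.
have [P' PP'] := row_freeP (minpoly_mx_free M).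
(* [Q] is forced by the formula for [k < d]. Both sides satisfy the recurrence of the minimal
   polynomial, which extends the formula to all integers. *)
pose Q := invmx W *m powers_mx M d.
exists d, lam, e, Q, (P' *m W); split.
- by rewrite /Q !mulmxA -[_ *m P']mulmxA PP' mulmx1 mulVmx.
- pose S k := mxvec (M ^ k) - w k *m Q.
  suff S0 : forall k, S k = 0 by move=> k; apply/eqP; rewrite -subr_eq0 -/(S k) S0.
  apply: (@recurrence_eq0 _ _ d (fun i => p`_i) S p0 pd) => [k|j jd].
    under eq_bigr do rewrite scalerBr scalemxAl -linearZ /=.
    rewrite sumrB -mulmx_suml wrec mul0mx subr0 -linear_sum /=.
    under eq_bigr do rewrite exprzDr // scalerAr.
    by rewrite -mulr_sumr -sp -horner_mx_sum mx_root_minpoly mulr0 linear0.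
  have wj : w j%:Z = row (Ordinal jd) W by rewrite rowK.
  rewrite /S wj -exprnP /Q mulmxA -row_mul mulmxV // -row_mul mul1mx rowK.
  by rewrite subrr.
- by move=> i; rewrite -rE.
- move=> a; rewrite -rE => ar; have := ar; rewrite -index_mem sr => ia.
  by exists (Ordinal ia); [exact: nth_index|exact: occ_index].
(* Diagonalizable means that the minimal polynomial has simple roots; a repeated root supplies an
   index with [e i = 1]. *)
- have -> : `[< diagonalizable M >] = uniq r.
    apply/asboolP/idP => [/diagonalizableP [rs urs]|ur].
      move=> prs; apply/negPn/negP => /(@occ_eq1 K 0 r) [i ir oi].
      have := occ_lt 0 ir; rewrite oi -mupE mup_geq // => /dvdp_trans /(_ prs).
      rewrite -mup_geq ?mu_prod_XsubC; last first.
        by rewrite monic_neq0 // monic_prod_XsubC.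
      by rewrite count_uniq_mem //; case: (_ \in _).
    by apply/diagonalizableP; exists r => //; rewrite -/p {1}pr.
  case: ifPn => [ur i|nur]; last first.
    have [j + oj] := occ_eq1 0 nur; rewrite sr => jd0; pose i' := Ordinal jd0.
    have := lamr i'; rewrite -index_mem sr => jd.
    exists i', (Ordinal jd); split=> //; last exact: occ_index.
    by rewrite /lam /= nth_index // mem_nth // sr.
  have ir : (i < size r)%N by rewrite sr.
  have := occ_lt 0 ir; rewrite (count_uniq_mem _ ur) /e.
  by case: (_ \in _) => //; rewrite ltnS leqn0 => /eqP.
Qed.

(** * Finitely generated multiplicative subgroups of a field *)

Lemma lmon_neq0 (K : fieldType) (s : nat) (x : 'rV[K]_s) (u : 'rV[int]_s) :
  torus x -> lmon x u != 0.
Proof. by move=> Tx; apply/prodf_neq0 => i _; rewrite expfz_neq0 ?Tx. Qed.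

Lemma lmon0 (K : fieldType) (s : nat) (x : 'rV[K]_s) : lmon x 0 = 1.
Proof. by rewrite /lmon big1 // => i _; rewrite mxE expr0z. Qed.

Lemma lmonD (K : fieldType) (s : nat) (x : 'rV[K]_s) (u v : 'rV[int]_s) :
  torus x -> lmon x (u + v) = lmon x u * lmon x v.
Proof.
move=> Tx; rewrite /lmon -big_split; apply: eq_bigr => i _ /=.
by rewrite mxE expfzDr ?Tx.
Qed.

Lemma lmonZ (K : fieldType) (s : nat) (x : 'rV[K]_s) (k : int)
    (u : 'rV[int]_s) : lmon x (k *: u) = lmon x u ^ k.
Proof.
rewrite /lmon; transitivity (\prod_i (x 0 i ^ u 0 i) ^ k).
  by apply: eq_bigr => i _; rewrite mxE mulrC exprz_exp.
elim/big_rec2: _ => [|i a b _ ->]; first by rewrite exp1rz.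
by rewrite expfzMl.
Qed.

Lemma lmonB (K : fieldType) (s : nat) (x : 'rV[K]_s) (u v : 'rV[int]_s) :
  torus x -> lmon x (u - v) = lmon x u / lmon x v.
Proof. by move=> Tx; rewrite lmonD // -scaleN1r lmonZ. Qed.

Lemma scale_rowz_eq0 (s k : nat) (u : 'rV[int]_s) :
  k%:Z *: u = 0 -> k != 0%N -> u = 0.
Proof.
move=> /rowP ku k0; apply/rowP => i; have /eqP := ku i.
by rewrite !mxE mulf_eq0 eqz_nat (negPf k0) => /eqP.
Qed.

Lemma lmon_delta (K : fieldType) (s : nat) (x : 'rV[K]_s) (i : 'I_s) :
  lmon x (delta_mx 0 i) = x 0 i.
Proof.
rewrite /lmon (bigD1 i) //= big1 => [|j ji]; rewrite !mxE eqxx.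
  by rewrite eqxx expr1z mulr1.
by rewrite (negPf ji) expr0z.
Qed.

Lemma monomial_mapE (K : fieldType) (m d : nat) (A : 'M[int]_(m, d))
    (x : 'rV[K]_d) (i : 'I_m) : monomial_map A x 0 i = lmon x (row i A).
Proof. by rewrite mxE; apply: eq_bigr => j _; rewrite mxE. Qed.

Lemma mul_subgroup_lmon (K : fieldType) (s : nat) (x : 'rV[K]_s) :
  torus x -> mul_subgroup (range (lmon x)).
Proof.
move=> Tx; split=> [_ [u _ <-]||_ _ [u _ <-] [v _ <-]].
- exact: lmon_neq0.
- by exists 0 => //; rewrite lmon0.
- by exists (u - v) => //; rewrite lmonB.
Qed.

Lemma mul_subgroupM (K : fieldType) (H : set K) (x y : K) :
  mul_subgroup H -> H x -> H y -> H (x * y).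
Proof.
move=> [_ H1 HV] Hx Hy; rewrite -[y]invrK; apply: (HV x) => //.
by rewrite -div1r; exact: HV.
Qed.

Lemma mul_subgroupXz (K : fieldType) (H : set K) (x : K) (k : int) :
  mul_subgroup H -> H x -> H (x ^ k).
Proof.
move=> sH Hx; have [_ H1 HV] := sH.
have HX (n : nat) : H (x ^+ n).
  by elim: n => [|n IHn] //; rewrite exprS; exact: mul_subgroupM.
by case: k => n; [exact: HX|rewrite NegzE -exprnN -div1r; exact: HV].
Qed.

Lemma mul_generated_lmon (K : fieldType) (s : nat) (x : 'rV[K]_s) (S : set K) :
  torus x -> (forall a, S a <-> exists i, x 0 i = a) ->
  mul_generated S = range (lmon x).
Proof.
move=> Tx Sx; apply/seteqP; split=> [z|_ [u _ <-] H [sH SH]].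
  apply; split; first exact: mul_subgroup_lmon.
  by move=> a /Sx [i <-]; exists (delta_mx 0 i) => //; rewrite lmon_delta.
apply: (big_ind H); first by have [] := sH.
  by move=> a b; exact: mul_subgroupM.
by move=> i _; apply: mul_subgroupXz => //; apply/SH/Sx; exists i.
Qed.

(** Membership in the group generated by [b] modulo [N]-th roots of unity; a common [N] for all
    elements later bounds the torsion. *)
Definition torsion_mod (K : fieldType) (r : nat) (b : 'rV[K]_r) (N : nat)
  (z : K) : Prop := exists u, (z / lmon b u) ^+ N = 1.

Lemma torsion_mod_lmon (K : fieldType) (r s : nat) (b : 'rV[K]_r) (N : nat)
    (x : 'rV[K]_s) (u : 'rV[int]_s) :
  torus b -> (forall i, torsion_mod b N (x 0 i)) -> torsion_mod b N (lmon x u).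
Proof.
move=> Tb xN; apply: (big_ind (torsion_mod b N)).
- by exists 0; rewrite lmon0 divr1 expr1n.
- move=> y z [v yv] [w zw]; exists (v + w).
  by rewrite lmonD // invfM mulrACA exprMn yv zw mulr1.
- move=> i _; have [v xv] := xN i; exists (u 0 i *: v).
  by rewrite lmonZ expfV -expfzMl exprnP exprzAC -exprnP xv exp1rz.
Qed.

(* A relation between the generators becomes, after a unimodular change of
   generators, a relation making one generator a root of unity. *)
Lemma free_mod_torsion (K : fieldType) (s : nat) (x : 'rV[K]_s) :
  torus x ->
  exists (r : nat) (b : 'rV[K]_r) (N : nat),
    [/\ torus b, (0 < N)%N, forall i, exists u, b 0 i = lmon x u,
        forall u, lmon b u = 1 -> u = 0 & forall i, torsion_mod b N (x 0 i)].
Proof.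
elim: s x => [|s IHs] x Tx.
  exists 0%N, x, 1%N; split=> // [[] //|u _|[] //].
  by apply/rowP => -[].
have [fx|/existsNP[e /not_implyP[xe e0]]] :=
    pselect (forall u, lmon x u = 1 -> u = 0).
  exists s.+1, x, 1%N; split=> // i; exists (delta_mx 0 i).
    by rewrite lmon_delta.
  by rewrite lmon_delta expr1 divff ?Tx.
(* The Smith form of a single row exhibits [e] as a multiple of the first row of a unimodular
   [P]. *)
have [L uL [P uP [d _ eLP]]] := int_Smith_normal_form e.
pose g := L 0 0 * d`_0.
have eg : e = g *: row 0 P.
  rewrite eLP; apply/rowP => j; rewrite !mxE (bigD1 0) //= big1 ?addr0.
    by rewrite !mxE big_ord1 !mxE eqxx mulr1n.
  move=> i i0; rewrite !mxE big_ord1 !mxE.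
  suff /negPf -> : (0 : 'I_1) != i :> nat by rewrite mulr0n mulr0 mul0r.
  by rewrite eq_sym.
have g0 : g != 0 by apply: contra_not_neq e0 => g0; rewrite eg g0 scale0r.
(* The new generator of index 0 satisfies [y_0^g = x^e = 1]; the induction hypothesis covers the
   others. *)
pose y := monomial_map P x.
have Ty : torus y by exact: torus_monomial_map.
have [r [b [N [Tb N0 by' fb yN]]]] :=
  IHs (monomial_map (row' ord0 P) x) (torus_monomial_map _ Tx).
exists r, b, (N * `|g|)%N; split=> //.
- by rewrite muln_gt0 N0 absz_gt0.
- move=> i; have [u ->] := by' i; exists (u *m row' ord0 P).
  exact: lmon_monomial_map.
have yT i : torsion_mod b (N * `|g|) (y 0 i).
  case: (unliftP ord0 i) => [j|] ->.
    have [u yu] := yN j; exists u; rewrite exprM.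
    move: yu; rewrite monomial_mapE row_rowsub /= -monomial_mapE => ->.
    by rewrite expr1n.
  exists 0; rewrite lmon0 divr1 mulnC exprM monomial_mapE.
  suff -> : lmon x (row ord0 P) ^+ `|g| = 1 by rewrite expr1n.
  have := xe; rewrite eg lmonZ; case: (g) => // n.
  by rewrite NegzE -exprnN => /eqP; rewrite invr_eq1 => /eqP.
move=> i; suff <- : lmon y (row i (invmx P)) = x 0 i by exact: torsion_mod_lmon.
by rewrite lmon_monomial_map // -row_mul mulVmx // row1 lmon_delta.
Qed.

(** Multiplication by [z] permutes [T], so multiplying the nonzero product of [T] by [z ^+ size T]
    leaves it unchanged. *)
Lemma seq_mul_unity (K : fieldType) (T : seq K) (z : K) :
  uniq T -> 0 \notin T -> z != 0 -> {in T, forall y, z * y \in T} ->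
  z ^+ size T = 1.
Proof.
move=> uT T0 z0 zT.
have pT : perm_eq [seq z * y | y <- T] T.
  have uzT : uniq [seq z * y | y <- T] by rewrite map_inj_uniq //; exact: mulfI.
  have sub : {subset [seq z * y | y <- T] <= T}.
    by move=> _ /seq.mapP[y yT ->]; exact: zT.
  apply: uniq_perm => //.
  by have [] := uniq_min_size uzT sub; rewrite ?size_map.
have PT0 : \prod_(y <- T) y != 0.
  by rewrite prodf_seq_neq0; apply/allP => y; apply: contraTneq => ->.
apply: (mulIf PT0); rewrite mul1r -[in RHS](perm_big _ pT) big_map big_split /=.
by rewrite big_const_seq count_predT -Monoid.iteropE.
Qed.

(** The single [N] of [free_mod_torsion] kills all torsion, which is therefore a finite group of
    roots of ['X^N - 1], and finite multiplicative groups in a field are cyclic. *)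
Lemma mul_group_structure (K : numClosedFieldType) (s : nat) (x : 'rV[K]_s) :
  let G := range (lmon x) in
  torus x ->
  exists (r : nat) (b : 'rV[K]_r) (t : nat) (zeta : K),
    [/\ torus b, forall u, lmon b u = 1 -> u = 0, t.-primitive_root zeta,
        torsion G = [set zeta ^+ i | i in `I_t] &
        [/\ range (lmon b) `<=` G, G zeta &
          forall z, G z -> exists u i, (i < t)%N /\ z = zeta ^+ i * lmon b u]].
Proof.
move=> G Tx; have sG : mul_subgroup G := mul_subgroup_lmon Tx.
have [r [b [N [Tb N0 bG fb xN]]]] := free_mod_torsion Tx.
have bsub : range (lmon b) `<=` G.
  move=> _ [u _ <-]; apply: (big_ind G); first by have [] := sG.
    by move=> y z; exact: mul_subgroupM.
  move=> i _; apply: mul_subgroupXz => //.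
  by have [v ->] := bG i; exists v.
have decG z : G z -> exists u, (z / lmon b u) ^+ N = 1.
  by move=> [v _ <-]; exact: torsion_mod_lmon.
have torN z : torsion G z <-> G z /\ z ^+ N = 1.
  split=> [[Gz [k k0 zk]]|[Gz zN]]; last by split=> //; exists N.
  (* Since [z] is [b^u] up to an [N]-th root of unity, [z ^+ k = 1] gives [b^(N k u) = 1], and
     freeness gives [u = 0]. *)
  split=> //; have [u zu] := decG z Gz.
  have : lmon b ((N * k)%N%:Z *: u) = 1.
    rewrite lmonZ -exprnP; have : (z / lmon b u) ^+ (N * k) = 1.
      by rewrite exprM zu expr1n.
    rewrite expr_div_n mulnC exprM zk expr1n div1r => /eqP.
    by rewrite invr_eq1 => /eqP.
  move=> /fb /scale_rowz_eq0 u0; move: zu.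
  by rewrite u0 ?lmon0 ?divr1 // muln_eq0 (gtn_eqF N0) gtn_eqF.
have [rs ers] := closed_field_poly_normal ('X^N - 1 : {poly K}).
have rsP z : z ^+ N = 1 -> z \in rs.
  move=> zN; rewrite -root_prod_XsubC; have : root ('X^N - 1%:P) z.
    by rewrite rootE hornerD hornerN hornerC hornerXn zN subrr.
  by rewrite ers rootZ // lead_coef_eq0 -size_poly_eq0 size_XnsubC.
pose T := [seq z <- undup rs | `[< torsion G z >]].
have TP z : (z \in T) = `[< torsion G z >].
  rewrite mem_filter mem_undup; apply/andP/asboolP => [[/asboolP //]|tz].
  by split; [exact/asboolP|have /torN [_ /rsP] := tz].
have T1 : 1 \in T.
  by rewrite TP; apply/asboolP; split; [have [] := sG|exists 1%N].
have T0 : 0 \notin T.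
  rewrite TP; apply/asboolP => -[_ [k k0]] /eqP.
  by rewrite expr0n gtn_eqF // eq_sym oner_eq0.
have uT : uniq T by rewrite filter_uniq // undup_uniq.
have TM : {in T &, forall y z, y * z \in T}.
  move=> y z; rewrite !TP => /asboolP/torN [Gy yN] /asboolP/torN [Gz zN].
  apply/asboolP/torN; split; first exact: mul_subgroupM.
  by rewrite exprMn yN zN mulr1.
have t0 : (0 < size T)%N by case: (T) T1.
have Tt : {in T, forall z, z ^+ size T = 1}.
  move=> z zT; apply: seq_mul_unity => //; first by apply: contraNneq T0 => <-.
  by move=> y yT; exact: TM.
have : has (size T).-primitive_root T.
  apply: has_prim_root => //; apply/allP => z /Tt zt.
  by rewrite unity_rootE zt.
case/hasP => zeta zT pz.
exists r, b, (size T), zeta.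
have powT z : z \in T -> exists2 i, (i < size T)%N & zeta ^+ i = z.
  by move=> /Tt /(prim_rootP pz) [i ->]; exists i.
have Gzeta : G zeta by move: zT; rewrite TP => /asboolP [].
split=> //.
  apply/seteqP; split=> z.
    by move=> tz; have /powT [k] : z \in T by [rewrite TP; apply/asboolP]; exists k.
  move=> [i _ <-]; apply/asboolP; rewrite -TP.
  by elim: i => [|i IHi] //; rewrite exprS; exact: TM.
split=> // z Gz; have [u zu] := decG z Gz.
have /powT [i iT zi] : z / lmon b u \in T.
  rewrite TP; apply/asboolP/torN; split=> //.
  by have [_ _ HV] := sG; apply: HV => //; apply: bsub; exists u.
by exists u, i; split=> //; rewrite zi divfK // lmon_neq0.
Qed.

Lemma lmon_inj (K : fieldType) (r : nat) (b : 'rV[K]_r) :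
  torus b -> (forall u, lmon b u = 1 -> u = 0) -> injective (lmon b).
Proof.
move=> Tb fb u v uv; apply/eqP; rewrite -subr_eq0; apply/eqP/fb.
by rewrite lmonB // uv divff // lmon_neq0.
Qed.

Lemma has_rank_lmon (K : fieldType) (r t : nat) (b : 'rV[K]_r) (zeta : K)
    (G : set K) :
  torus b -> (forall u, lmon b u = 1 -> u = 0) -> range (lmon b) `<=` G ->
  torsion G = [set zeta ^+ i | i in `I_t] ->
  (forall z, G z -> exists u i, (i < t)%N /\ z = zeta ^+ i * lmon b u) ->
  has_rank G r.
Proof.
move=> Tb fb bG tG decG; exists (range (lmon b)).
  have sb := mul_subgroup_lmon Tb; split=> //.
    apply/seteqP; split=> [z [[_ [k k0 zk]] [u _ ub]]|_ ->] /=.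
      have : lmon b (k%:Z *: u) = 1 by rewrite lmonZ ub.
      by move=> /fb /scale_rowz_eq0 u0; rewrite -ub u0 ?lmon0 // gtn_eqF.
    have [_ b1 _] := sb; split=> //; split; first exact: bG.
    by exists 1%N.
  move=> z /decG [u [i [it ->]]]; exists (zeta ^+ i), (lmon b u); split=> //.
  by rewrite tG; exists i.
exists (b 0); split=> [u _|u v _ _|z].
- by exists u.
- exact: lmon_inj.
- by case=> u _ <-; exists u.
Qed.

(** * Components and dimension of a finite union *)

(** An irreducible subset of the union lies in one [X i]; in the absence of inclusions this makes
    each [X i] maximal. *)
Lemma zcomponents_bigcup (K : fieldType) (n t : nat) (X : nat -> set 'rV[K]_n) :
  (forall i, zclosed (X i)) -> (forall i, zirreducible (X i)) ->
  (forall i j, (i < t)%N -> (j < t)%N -> X i `<=` X j -> i = j) ->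
  zcomponents (\bigcup_(i in `I_t) X i) = X @` `I_t.
Proof.
move=> cX iX incX; apply/seteqP; split=> [Z [iZ ZX maxZ]|_ [i ilt <-]].
  have [i ilt ZXi] := zirreducible_bigcup cX iZ ZX.
  by exists i => //; apply: maxZ => //; exact: bigcup_sup.
split=> //; first exact: bigcup_sup.
move=> W iW WX XW; have [j jlt WXj] := zirreducible_bigcup cX iW WX.
have ij := incX i j ilt jlt (subset_trans XW WXj).
by apply/seteqP; split=> //; rewrite ij.
Qed.

(** The top of a chain is irreducible, so it lies in one [X i] and takes the whole chain with it. *)
Lemma has_zdim_bigcup (K : fieldType) (n t d : nat) (X : nat -> set 'rV[K]_n) :
  (0 < t)%N -> (forall i, zclosed (X i)) -> (forall i, has_zdim (X i) d) ->
  has_zdim (\bigcup_(i in `I_t) X i) d.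
Proof.
move=> t0 cX dX; split.
  have [[C [irrC ltC]] _] := dX 0%N; exists C; split=> // i id.
  by have [cC iC CX] := irrC i id; split=> // x /CX Xx; exists 0%N.
move=> e C chC; have [irrC ltC] := chC.
have [_ iCe CeX] := irrC e (leqnn e).
have [i _ CeXi] := zirreducible_bigcup cX iCe CeX.
have [_ maxX] := dX i; apply: (maxX e C); split=> // j je.
have [cC iC _] := irrC j je; split=> //.
exact: subset_trans (zchain_sub chC je (leqnn e)) CeXi.
Qed.

(** * Density of the powers *)

(* [b] is a basis of a free subgroup of [K^*]; the [lam_i^t] are in it.  The
   extra coordinate of [exp_point] carries the exponent itself, and is only there
   when [delta]. *)
Definition exp_matrix (m r : nat) (delta : bool) (E : 'M[int]_(m, r))
    (e : 'I_m -> nat) : 'M[int]_(m, r + delta) :=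
  row_mx E (\matrix_(i, j) (e i)%:Z).

Definition exp_point (K : fieldType) (r t : nat) (delta : bool) (b : 'rV[K]_r)
    (k : int) : 'rV[K]_(r + delta) :=
  row_mx (\row_j b 0 j ^ (t%:Z * k)) (const_mx (t%:Z * k)%:~R).

(** At [k = 0] the extra coordinate is zero, which is harmless because its exponents [e i] are
    natural numbers. *)
Lemma exp_point_mono_dom (K : fieldType) (m r t : nat) (delta : bool)
    (E : 'M[int]_(m, r)) (e : 'I_m -> nat) (b : 'rV[K]_r) (k : int) :
  torus b -> mono_dom (exp_matrix delta E e) (exp_point t delta b k).
Proof.
move=> Tb j; case: (splitP j) => l jl.
  have -> : j = lshift delta l by exact: val_inj.
  by left; rewrite row_mxEl mxE expfz_neq0.
have -> : j = rshift r l by exact: val_inj.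
by right=> i; rewrite row_mxEr mxE.
Qed.

Lemma torus_exp_point (K : numFieldType) (r t : nat) (delta : bool)
    (b : 'rV[K]_r) (k : int) :
  torus b -> (0 < t)%N -> k != 0 -> torus (exp_point t delta b k).
Proof.
move=> Tb t0 k0 j; case: (splitP j) => l jl.
  have -> : j = lshift delta l by exact: val_inj.
  by rewrite row_mxEl mxE expfz_neq0.
have -> : j = rshift r l by exact: val_inj.
by rewrite row_mxEr mxE intr_eq0 mulf_neq0 // eqz_nat gtn_eqF.
Qed.

Lemma lmon_exp_point (K : fieldType) (r t : nat) (delta : bool) (b : 'rV[K]_r)
    (k : int) (g : 'rV[int]_(r + delta)) :
  lmon (exp_point t delta b k) g =
  lmon b (lsubmx g) ^ (t%:Z * k) * \prod_(j < delta) (t%:Z * k)%:~R ^ rsubmx g 0 j.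
Proof.
rewrite /lmon big_split_ord /=; congr (_ * _).
  transitivity (lmon b ((t%:Z * k) *: lsubmx g)); last by rewrite lmonZ.
  by apply: eq_bigr => j _; rewrite row_mxEl !mxE exprz_exp mulrC.
by apply: eq_bigr => j _; rewrite row_mxEr !mxE.
Qed.

(** The rows of [E] determine [lam] only up to [t]-th roots of unity, hence the restriction to
    exponents that are multiples of [t]. *)
Lemma monomial_map_exp_point (K : fieldType) (m r t : nat) (delta : bool)
    (E : 'M[int]_(m, r)) (e : 'I_m -> nat) (b : 'rV[K]_r) (lam : 'rV[K]_m)
    (k : int) :
  (forall i, lam 0 i ^+ t = lmon b (row i E) ^+ t) ->
  (~~ delta -> forall i, e i = 0%N) ->
  monomial_map (exp_matrix delta E e) (exp_point t delta b k) =
  \row_i (lam 0 i ^ (t%:Z * k) * (t%:Z * k)%:~R ^+ e i).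
Proof.
move=> lamE e0; apply/rowP => i; rewrite monomial_mapE lmon_exp_point mxE.
congr (_ * _).
  rewrite -!exprz_exp -!exprnP lamE; congr (lmon _ _ ^+ _ ^ _).
  by apply/rowP=> j; rewrite [LHS]mxE [LHS]mxE row_mxEl [RHS]mxE.
case: delta e0 => [_|/(_ isT) ->]; last by rewrite big_ord0 expr0.
rewrite big_ord1 [rsubmx _ _ _]mxE [row _ _ _ _]mxE row_mxEr mxE.
by rewrite -exprnP.
Qed.

Lemma big_group_by (K : fieldType) (I J : eqType) (r : seq I) (f : I -> J)
    (c : I -> K) (F : J -> K) :
  \sum_(i <- r) c i * F (f i) =
  \sum_(j <- undup [seq f i | i <- r]) (\sum_(i <- r | f i == j) c i) * F j.
Proof.
under [in RHS]eq_bigr do rewrite mulr_suml big_mkcond.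
rewrite exchange_big; apply: eq_big_seq => i ir /=.
rewrite (bigD1_seq (f i)) ?undup_uniq //=; last by rewrite mem_undup map_f.
by rewrite eqxx big1 ?addr0 // => j; rewrite eq_sym => /negPf ->.
Qed.

(** At the points [exp_point], [f] becomes an exponential polynomial in [k]. By freeness of [b],
    distinct weights give distinct exponential monomials, so the total coefficient of each weight is
    zero. *)
Lemma vanish_monomial_map (K : numFieldType) (m r t : nat) (delta : bool)
    (E : 'M[int]_(m, r)) (e : 'I_m -> nat) (b : 'rV[K]_r) (f : {mpoly K[m]}) :
  let A := exp_matrix delta E e in
  torus b -> (forall u, lmon b u = 1 -> u = 0) -> (0 < t)%N ->
  (forall k : nat, (0 < k)%N ->
    f.@[monomial_map A (exp_point t delta b k%:Z) 0] = 0) ->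
  forall x, mono_dom A x -> f.@[monomial_map A x 0] = 0.
Proof.
move=> A Tb fb t0 fk x Ax; rewrite meval_monomial_map //.
pose wt := mnm_weight A; pose W := undup [seq wt bt | bt <- msupp f].
pose c g := \sum_(bt <- msupp f | wt bt == g) f@_bt.
rewrite (big_group_by (msupp f) wt (fun bt => f@_bt) (lmon x)) -/W.
suff c0 : {in W, forall g, c g = 0}.
  by rewrite big_seq big1 // => g /c0; rewrite /c => ->; rewrite mul0r.
(* As [delta] is at most 1, this is the exponent of the extra coordinate, or 0 if there is none. *)
pose s (g : 'rV[int]_(r + delta)) := \sum_j rsubmx g 0 j.
have W0 g : g \in W -> forall j, 0 <= rsubmx g 0 j.
  rewrite mem_undup => /seq.mapP[bt _ ->] j; rewrite !mxE sumr_ge0 // => i _.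
  by rewrite mulrn_wge0 // row_mxEr mxE.
have s0 g : g \in W -> 0 <= s g by move=> gW; rewrite sumr_ge0 // => j _; exact: W0.
(* The factor comes from [(t k)^s = t^s k^s] and is nonzero as [t] is positive. *)
suff cs : {in W, forall g, c g * t%:R ^+ `|s g| = 0}.
  move=> g /cs /eqP; rewrite mulf_eq0 expf_eq0 pnatr_eq0 (gtn_eqF t0) andbF orbF.
  by move=> /eqP.
apply: (@exp_monomial_family_indep _ _ W (fun g => lmon b (lsubmx g) ^+ t)
  (fun g => `|s g|%N) _ 1) => [||g _|k k0].
- exact: undup_uniq.
- move=> g h gW hW [gh sgh]; rewrite -[g]hsubmxK -[h]hsubmxK; congr row_mx.
    apply/eqP; rewrite -subr_eq0; apply/eqP.
    apply: (@scale_rowz_eq0 _ t); last by rewrite gtn_eqF.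
    apply: fb; rewrite lmonZ lmonB // -exprnP expr_div_n gh divff //.
    by rewrite expf_neq0 // lmon_neq0.
  have {}sgh : s g = s h by rewrite -[LHS]gez0_abs ?s0 // sgh gez0_abs ?s0.
  apply/rowP => j; move: sgh; rewrite /s; case: (delta) g h j {gW hW gh} => g h j.
    by rewrite !big_ord1 (ord1 j).
  by case: j.
- by rewrite expf_neq0 // lmon_neq0.
rewrite -[RHS](fk k k0) meval_monomial_map; last exact: exp_point_mono_dom.
rewrite (big_group_by (msupp f) wt (fun bt => f@_bt) (lmon _)) -/W.
apply: eq_big_seq => g gW; rewrite -/(c g) -mulrA; congr (_ * _).
rewrite lmon_exp_point prod_exprz; last by right; exact: W0.
rewrite -/(s g) -exprz_exp -!exprnP -[in RHS](gez0_abs (s0 g gW)) -exprnP.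
by rewrite -PoszM -pmulrn natrM exprMn mulrCA.
Qed.

(** Both inclusions rest on the points with [k > 0], which lie in the torus. The point with [k = 0]
    may lie outside it and is reached through [mono_dom]. *)
Lemma zclosure_exp_points (K : numFieldType) (m r t : nat) (delta : bool)
    (E : 'M[int]_(m, r)) (e : 'I_m -> nat) (b : 'rV[K]_r) :
  let A := exp_matrix delta E e in
  torus b -> (forall u, lmon b u = 1 -> u = 0) -> (0 < t)%N ->
  zclosure [set monomial_map A (exp_point t delta b k) | k in [set: int]] =
  toricY A.
Proof.
move=> A Tb fb t0.
apply: eq_zclosure => [_ [k _ <-]|_ [x Tx <-]]; apply/zclosureP => f fX.
  apply: (@vanish_monomial_map _ _ _ t) => // [l l0|].
    apply: fX; exists (exp_point t delta b l%:Z) => //.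
    by apply: torus_exp_point => //; rewrite eqz_nat gtn_eqF.
  exact: exp_point_mono_dom.
apply: (@vanish_monomial_map _ _ _ t _ _ _ b) => // [l l0|].
  by apply: fX; exists l%:Z.
exact: torus_mono_dom.
Qed.

(** * The closure of a cyclic matrix group *)

(** Each [b j] is a monomial in [lam], so the rows of [E] generate the lattice; the extra unit
    vector is a difference of two rows belonging to the same eigenvalue. *)
Lemma exp_matrix_left_inverse (K : fieldType) (m r t : nat) (delta : bool)
    (lam : 'rV[K]_m) (e : 'I_m -> nat) (b : 'rV[K]_r) (E : 'M[int]_(m, r)) :
  torus lam -> torus b -> (0 < t)%N -> (forall u, lmon b u = 1 -> u = 0) ->
  range (lmon b) `<=` range (lmon lam) ->
  (forall i, lam 0 i ^+ t = lmon b (row i E) ^+ t) ->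
  (forall i, exists j, lam 0 j = lam 0 i /\ e j = 0%N) ->
  (delta -> exists i j, [/\ lam 0 i = lam 0 j, e i = 1%N & e j = 0%N]) ->
  exists B, B *m exp_matrix delta E e = 1%:M.
Proof.
move=> Tlam Tb t0 fb bG lamE e0 e1.
have b_t_inj u v : lmon b u ^+ t = lmon b v ^+ t -> u = v.
  move=> uv; apply/eqP; rewrite -subr_eq0; apply/eqP.
  apply: (@scale_rowz_eq0 _ t); last by rewrite gtn_eqF.
  apply: fb; rewrite lmonZ lmonB // -exprnP expr_div_n uv divff //.
  by rewrite expf_neq0 // lmon_neq0.
have row_eq i j : lam 0 i = lam 0 j -> row i E = row j E.
  by move=> lij; apply: b_t_inj; rewrite -!lamE lij.
have [sg sgP] := choice e0.
have [U UP] : {U : 'I_r -> 'rV[int]_m & forall j, lmon lam (U j) = b 0 j}.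
  apply: (@choice _ _ (fun j u => lmon lam u = b 0 j)) => j.
  have [|u _ ub] := bG (b 0 j); last by exists u.
  by exists (delta_mx 0 j) => //; rewrite lmon_delta.
have UE : (\matrix_j U j) *m E = 1%:M.
  apply/row_matrixP => j; rewrite row_mul rowK row1; apply: b_t_inj.
  rewrite lmon_delta -UP -(lmon_monomial_map _ _ Tb) /lmon -!prodrXl.
  apply: eq_bigr => i _; rewrite -/(lmon _ _) monomial_mapE !exprnP exprzAC.
  by rewrite [RHS]exprzAC -!exprnP lamE.
(* [P] replaces each index by one with the same eigenvalue and [e = 0], so it preserves [E] and
   kills the extra column. *)
pose P : 'M[int]_m := \matrix_i delta_mx 0 (sg i).
have PE : P *m E = E.
  apply/row_matrixP => i; rewrite row_mul rowK -rowE.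
  by apply: row_eq; have [] := sgP i.
pose J : 'M[int]_(m, delta) := \matrix_(i, j) (e i)%:Z.
have PJ : P *m J = 0.
  apply/row_matrixP => i; rewrite row_mul rowK -rowE row0.
  by apply/rowP=> j; rewrite !mxE; have [_ ->] := sgP i.
have [v [vE vJ]] : exists v : 'M[int]_(delta, m), v *m E = 0 /\ v *m J = 1%:M.
  move: @J PJ e1; case: (delta) => J PJ e1; last first.
    by exists 0; rewrite !mul0mx; split=> //; apply/matrixP => -[].
  have [i [j [lij ei ej]]] := e1 isT.
  exists (delta_mx 0 i - delta_mx 0 j); rewrite !mulmxBl -!rowE.
  rewrite (row_eq _ _ lij) subrr; split=> //.
  by apply/matrixP=> k l; rewrite !ord1 !mxE ei ej.
exists (col_mx ((\matrix_j U j) *m P) v).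
rewrite mul_col_row -!mulmxA PE PJ UE vE vJ mulmx0.
by rewrite -scalar_mx_block.
Qed.

Lemma cyclic_closure (K : numClosedFieldType) (n : nat) (M : 'M[K]_n.+1)
    (hM : M \in unitmx) :
  let Xbar := zclosure [set mxvec (M ^ k) | k in [set: int]] in
  let G := mul_generated [set a : K | eigenvalue M a] in
  [/\ finite_set (torsion G),
      (zcomponents Xbar #= torsion G)%card,
      forall Z, zcomponents Xbar Z -> toric Z,
      forall Z W, zcomponents Xbar Z -> zcomponents Xbar W ->
        zisomorphic Z W &
      exists2 r, has_rank G r &
        let d := if `[< diagonalizable M >] then r else r.+1 in
        has_zdim Xbar d /\
        (forall Z, zcomponents Xbar Z -> has_zdim Z d)].
Proof.
move=> Xbar G.
have [m [lam_ [e [Q [Q' [QQ' powM lamP eigP diagP]]]]]] := powers_exp_monomials hM.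
pose lam : 'rV[K]_m := \row_i lam_ i.
have lamE i : lam 0 i = lam_ i by rewrite mxE.
have Tlam : torus lam by move=> i; rewrite lamE; have [] := lamP i.
have GE : G = range (lmon lam).
  apply: mul_generated_lmon => // a; split=> [/eigP [i <- _]|[i <-]].
    by exists i.
  by rewrite lamE; have [] := lamP i.
have [r [b [t [zeta [Tb fb pz tG [bG Gz decG]]]]]] := mul_group_structure Tlam.
have t0 : (0 < t)%N := prim_order_gt0 pz.
rewrite -GE in tG bG Gz decG.
have rkG := has_rank_lmon Tb fb bG tG decG.
pose delta := ~~ `[< diagonalizable M >].
have e_delta : ~~ delta -> forall i, e i = 0%N.
  by rewrite negbK => dM; move: diagP; rewrite dM.
have [E EP] : exists E : 'M[int]_(m, r),
    forall i, lam 0 i ^+ t = lmon b (row i E) ^+ t.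
  (* The [t]-th power removes the torsion factor [zeta ^+ k]. *)
  have /choice [E EP] : forall i, exists u, lam 0 i ^+ t = lmon b u ^+ t.
    move=> i; have Gi : G (lam 0 i).
      by rewrite GE; exists (delta_mx 0 i) => //; rewrite lmon_delta.
    have [u [k [_ ->]]] := decG _ Gi; exists u.
    by rewrite exprMn exprAC (prim_expr_order pz) expr1n mul1r.
  by exists (\matrix_i E i) => i; rewrite rowK.
pose A := exp_matrix delta E e.
have e0P i : exists j, lam 0 j = lam 0 i /\ e j = 0%N.
  have [_ /eigP [j lji ej]] := lamP i.
  by exists j; rewrite !lamE.
have [B BA] : exists B, B *m A = 1%:M.
  apply: (exp_matrix_left_inverse Tlam Tb t0 fb) => //; first by rewrite -GE.
  move=> dlt; move: diagP; rewrite (negPf dlt) => -[i [j [lij ei ej]]].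
  by exists i, j; rewrite !lamE.
pose S (i : nat) := [set mxvec (M ^ (i%:Z + t%:Z * l)) | l in [set: int]].
pose X i := zclosure (S i).
have cX i : zclosed (X i) by exact: zclosed_closure.
have X0 : zisomorphic (X 0%N) (@toricY K m _ A).
  rewrite /A -(@zclosure_exp_points K m r t delta E e b Tb fb t0).
  apply: (@zisomorphic_closure _ _ _ (linpoly Q') (linpoly Q)) => [_ [l _ <-]|_ [l _ <-]|x|x].
  - rewrite /= polymap_lin powM -mulmxA QQ' mulmx1.
    exists l => //; rewrite (monomial_map_exp_point _ EP) // add0r.
    by apply/rowP=> i; rewrite !mxE.
  - rewrite /= polymap_lin (monomial_map_exp_point _ EP) //.
    exists l => //; rewrite powM add0r; congr (_ *m _).
    by apply/rowP=> i; rewrite !mxE.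
  - rewrite inE => -[l _ <-].
    by rewrite !polymap_lin powM -(mulmxA _ Q Q') QQ' mulmx1.
  - by rewrite inE => -[l _ <-]; rewrite !polymap_lin -mulmxA QQ' mulmx1.
have uMi i : M ^ i \is a GRing.unit by rewrite unitrXz.
(* Left multiplication by [M ^ i] is linear and carries the coset of 0 onto that of [i]. *)
have Xi i : zisomorphic (X i) (X 0%N).
  have mulP (N B' : 'M[K]_n.+1) :
      polymap (linpoly (lin_mulmx N)) (mxvec B') = mxvec (N *m B').
    by rewrite polymap_lin mul_vec_lin.
  apply: (@zisomorphic_closure _ _ _ (linpoly (lin_mulmx (M ^ - i%:Z)))
    (linpoly (lin_mulmx (M ^ i%:Z)))) => [_ [l _ <-]|_ [l _ <-]|x|x].
  - exists l => //; rewrite mulP -[_ *m _]/(M ^ (- i%:Z) * _) -exprzDr //.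
    by rewrite addrA addNr.
  - exists l => //; rewrite mulP -[_ *m _]/(M ^ i%:Z * _) -exprzDr //.
    by rewrite add0r.
  - rewrite inE => -[l _ <-]; rewrite !mulP mulmxA -[_ *m _ *m _]/(_ * _ * _).
    by rewrite -exprzDr // subrr expr0z mul1r.
  - rewrite inE => -[l _ <-]; rewrite !mulP mulmxA -[_ *m _ *m _]/(_ * _ * _).
    by rewrite -exprzDr // addNr expr0z mul1r.
have iX i : zirreducible (X i).
  apply: (zisomorphic_irreducible (zisomorphic_sym (Xi i))).
  have iA : zirreducible (@toricY K m _ A) by exact: (@toricY_irreducible K m _ A).
  by have := zisomorphic_irreducible (zisomorphic_sym X0) iA.
have XbarE : Xbar = \bigcup_(i in `I_t) X i.
  apply/seteqP; split.
    apply: zclosure_min; first exact: zclosed_bigcup.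
    move=> _ [k _ <-]; have tk : t%:Z != 0 by rewrite eqz_nat gtn_eqF.
    exists `|(k %% t%:Z)%Z|%N => /=.
      by rewrite -ltz_nat gez0_abs ?modz_ge0 // ltz_pmod.
    apply: sub_zclosure; exists (k %/ t%:Z)%Z => //.
    by rewrite gez0_abs ?modz_ge0 // addrC mulrC -divz_eq.
  move=> x [i _]; move: x; apply: zclosureS => _ [l _ <-].
  by exists (i%:Z + t%:Z * l).
(* [zeta] is a Laurent monomial in the eigenvalues, so [zeta ^ k] is that monomial in their [k]-th
   powers, and it equals [zeta ^+ j] on the [j]-th coset. This equation persists on the closure, so
   an inclusion forces [zeta ^+ i = zeta ^+ j]. *)
have incX i j : (i < t)%N -> (j < t)%N -> X i `<=` X j -> i = j.
  move=> it jt XiXj.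
  have [sg sgP] := choice e0P.
  (* After [Q'], this selects for each index a coordinate with the same eigenvalue and [e = 0],
     hence [lam_ l ^ k] without a factor in [k]. *)
  pose P : 'M[K]_m := \matrix_(l, k) (l == sg k)%:R.
  have coordP k : polymap (linpoly (Q' *m P)) (mxvec (M ^ k)) =
      \row_l lam_ l ^ k.
    rewrite polymap_lin powM -mulmxA (mulmxA Q) QQ' mul1mx.
    apply/rowP=> l; rewrite mxE (bigD1 (sg l)) //= big1 ?addr0.
      have [lsg esg] := sgP l; rewrite !mxE eqxx esg mulr1 mulr1.
      by rewrite -!lamE lsg.
    by move=> h /negPf hl; rewrite !mxE hl mulr0.
  have [u _ uz] : range (lmon lam) zeta by rewrite -GE.
  have [p pP] := laurent_eq u (zeta ^+ j).
  have Tk k : torus (\row_l lam_ l ^ k : 'rV[K]_m).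
    by move=> l; rewrite mxE expfz_neq0 // -lamE.
  have lmonk k : lmon (\row_l lam_ l ^ k) u = zeta ^ k.
    rewrite -uz -lmonZ; apply: eq_bigr => l _.
    by rewrite !mxE exprz_exp.
  pose Zp : set 'rV[K]_m := zero_locus [set p].
  have cZp : zclosed Zp by exists [set p].
  have : (polymap (linpoly (Q' *m P)) @^-1` Zp) (mxvec (M ^ i%:Z)).
    have : X j (mxvec (M ^ i%:Z)).
      by apply: XiXj; apply: sub_zclosure; exists 0 => //; rewrite mulr0 addr0.
    apply: (zclosure_min (zclosed_preimage _ cZp)) => _ [l _ <-] /= q ->.
    rewrite coordP; apply/pP => //; rewrite lmonk.
    rewrite expfzDr ?(prim_root_eq0 pz) ?gtn_eqF // -exprz_exp -!exprnP.
    by rewrite (prim_expr_order pz) exp1rz mulr1.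
  move=> /(_ p erefl); rewrite coordP => /pP -/(_ (Tk _)).
  rewrite lmonk -exprnP => /eqP; rewrite (eq_prim_root_expr pz).
  by rewrite !modn_small // => /eqP.
have compE : zcomponents Xbar = X @` `I_t by rewrite XbarE; exact: zcomponents_bigcup.
have dE : (if `[< diagonalizable M >] then r else r.+1) = (r + delta)%N.
  by rewrite /delta; case: `[< _ >]; rewrite ?addn0 ?addn1.
have dX i : has_zdim (X i) (r + delta).
  apply: (zisomorphic_zdim _ (cX i) (zisomorphic_sym (Xi i))) => //.
  apply: (zisomorphic_zdim _ (cX 0%N) (zisomorphic_sym X0)).
    exact: zclosed_closure.
  exact: toricY_zdim BA.
split.
- by rewrite tG; apply: finite_image; exact: finite_II.
- rewrite compE tG; apply: (@card_eq_trans _ _ _ _ `I_t).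
    by apply: inj_card_eq => i j; rewrite !inE => it jt Xij; apply: incX => //; rewrite Xij.
  rewrite card_eq_sym; apply: inj_card_eq => i j; rewrite !inE => it jt /eqP.
  by rewrite (eq_prim_root_expr pz) !modn_small // => /eqP.
- rewrite compE => _ [i _ <-]; exists m, (r + delta)%N, A.
  exact: zisomorphic_trans (Xi i) X0.
- rewrite compE => _ _ [i _ <-] [j _ <-].
  exact: zisomorphic_trans (Xi i) (zisomorphic_sym (Xi j)).
- exists r => //=; rewrite dE compE; split; last by move=> _ [i _ <-].
  by rewrite XbarE; exact: has_zdim_bigcup.
Qed.

Theorem theorem8 (R : realType) (n : nat) (M : 'M[R[i]]_n.+1)
    (hM : M \in unitmx) :
  let Xbar := zclosure [set mxvec (M ^ k) | k in [set: int]] in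
  let G := mul_generated [set a : R[i] | eigenvalue M a] in
  [/\ finite_set (torsion G),
      (zcomponents Xbar #= torsion G)%card,
      forall Z, zcomponents Xbar Z -> toric Z,
      forall Z W, zcomponents Xbar Z -> zcomponents Xbar W ->
        zisomorphic Z W &
      exists2 r, has_rank G r &
        let d := if `[< diagonalizable M >] then r else r.+1 in
        has_zdim Xbar d /\
        (forall Z, zcomponents Xbar Z -> has_zdim Z d)].
Proof. exact: cyclic_closure. Qed.
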